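(* Let $\tau\in\mathbb{C}$ with $\mathrm{Im}(\tau)>0$, $q=e^{2\pi i\tau}$, $u,v,\alpha\in\mathbb{C}$, and put $x=e^{2\pi iu}$, $y=e^{2\pi iv}$, $a=q^{\alpha}=e^{2\pi i\alpha\tau}$, $(x/y)^{\alpha/2}=e^{\pi i\alpha(u-v)}$. Let $x',y'$ be free nonzero complex parameters. Then, for generic values of the parameters, the generalized Zwegers $\mu$-function $\mu(x,y;a)$ satisfies the following three formulas. (i) If none of $y,\ x/a,\ yx',\ xx'/a,\ yy',\ xy'/a,\ y'/x',\ xyx'y'/a$ is an integer power of $q$, then $$ \mu(x,y;a) = x'\,\frac{\theta(xyy'/q^{2}a)\,\theta(yx')\,\theta(xx'/a)\,\theta(q/y')}{\theta(xyx'y'/q^{2}a)\,\theta(y)\,\theta(x/a)\,\theta(y'/x')}\,\mu(xx',yx';a) + y'\,\frac{\theta(xyx'/q^{2}a)\,\theta(xy'/a)\,\theta(yy')\,\theta(q/x')}{\theta(xyx'y'/q^{2}a)\,\theta(y)\,\theta(x/a)\,\theta(x'/y')}\,\mu(xy',yy';a). $$ (ii) If none of $y,\ x/a,\ yx',\ xx'/a,\ xx',\ yx'/a,\ y/x$ is an integer power of $q$, then $$ \mu(x,y;a) = x'\,\frac{\theta(x/q^{2})\,\theta(yx')\,\theta(xx'/a)\,\theta(qy/a)}{\theta(xx'/q^{2})\,\theta(y)\,\theta(x/a)\,\theta(a/yx')}\,\mu(xx',yx';a) - iq^{-\frac18}\Big(\frac{x}{y}\Big)^{\frac{\alpha}{2}}\frac{a}{y}\,\frac{\theta(xyx'/q^{2}a)\,\theta(q/x')\,(a,qy/x)_{\infty}}{\theta(xx'/q^{2})\,\theta(y)\,\theta(x/a)\,\theta(yx'/a)}\;{}_{0}\phi_{1}\!\left(\begin{matrix}-\\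 qy/x\end{matrix};q,\frac{q^{2}y}{ax}\right). $$ (iii) If none of $y,\ x/a,\ a,\ x/y$ is an integer power of $q$, then $$ \mu(x,y;a) = -iq^{-\frac18}\Big(\frac{x}{y}\Big)^{\frac{\alpha}{2}}\frac{a}{x}\,\frac{\theta(x/q^{2})\,\theta(qy/a)\,(a,qx/y)_{\infty}}{\theta(a/q^{2})\,\theta(y)\,\theta(x/a)\,\theta(x/y)}\;{}_{0}\phi_{1}\!\left(\begin{matrix}-\\ qx/y\end{matrix};q,\frac{q^{2}x}{ay}\right) - iq^{-\frac18}\Big(\frac{x}{y}\Big)^{\frac{\alpha}{2}}\frac{a}{y}\,\frac{\theta(y/q^{2})\,\theta(qx/a)\,(a,qy/x)_{\infty}}{\theta(a/q^{2})\,\theta(y)\,\theta(x/a)\,\theta(y/x)}\;{}_{0}\phi_{1}\!\left(\begin{matrix}-\\ qy/x\end{matrix};q,\frac{q^{2}y}{ax}\right). $$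
   Context: Notation. $q=e^{2\pi i\tau}$ with $\mathrm{Im}(\tau)>0$, and $q^{s}:=e^{2\pi i\tau s}$ for complex $s$. $(z)_\infty=(z;q)_\infty:=\prod_{j\ge0}(1-zq^{j})$; $(z)_n:=(z)_\infty/(q^{n}z)_\infty$ for $n\in\mathbb{Z}$; $(z_1,\dots,z_r)_n:=(z_1)_n\cdots(z_r)_n$ for $n\in\mathbb{Z}\cup\{\infty\}$. $\theta(z):=(z,q/z)_\infty$. The basic hypergeometric series is ${}_0\phi_1\!\left(\begin{matrix}-\\ b\end{matrix};q,z\right):=\sum_{n\ge0}\dfrac{q^{n(n-1)}}{(b)_n(q)_n}z^{n}$. The theta function is $\vartheta_{11}(u):=\sum_{n\in\mathbb{Z}}e^{2\pi i(n+\frac12)(u+\frac12)+\pi i(n+\frac12)^2\tau}=-iq^{\frac18}e^{-\pi iu}(q,e^{2\pi iu},qe^{-2\pi iu})_\infty$. The generalized Zwegers $\mu$-function is $$ \mu(x,y;a)=\mu(u,v;\alpha):=\frac{e^{\pi i\alpha(u-v)}}{\vartheta_{11}(v)}\sum_{n\in\mathbb{Z}}(-1)^{n}e^{2\pi i(n+\frac12)v}q^{\frac{n(n+1)}{2}}\frac{(e^{2\pi iu}q^{n+1})_\infty}{(e^{2\pi iu}q^{n-\alpha+1})_\infty}, $$ where $x=e^{2\pi iu}$, $y=e^{2\pi iv}$, $a=q^{\alpha}=e^{2\pi i\alpha\tau}$. Equivalently, with $(x/y)^{\alpha/2}=e^{\pi i\alpha(u-v)}$, $$ \mu(x,y;a)=-iq^{-\frac18}\frac{(x/y)^{\alpha/2}}{(q)_\infty\theta(y)}\frac{(x)_\infty}{(x/a)_\infty}\sum_{n\in\mathbb{Z}}\frac{(x/a)_n}{(x)_n}(-1)^nq^{\frac{n(n-1)}{2}}y^n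 . $$ For $w=e^{2\pi iz}$, $\mu(xw,yw;a)$ means $\mu(u+z,v+z;\alpha)$ (same $\alpha$); its prefactor is again $e^{\pi i\alpha(u-v)}$, so it does not depend on the choice of $z$. *)

(* Defs.v *)
From Stdlib Require Export Reals ZArith.
From Coquelicot Require Export Coquelicot.

Open Scope C_scope.

(* [Cseq_lim] and [Cseries] are total, as [RInt] is: they return the unique
   limit when there is one and an unspecified value otherwise. *)
Definition Cseq_lim (f : nat -> C) : C :=
  iota (fun l : C_CompleteNormedModule => filterlim f eventually (locally l)).

Definition Cseries (f : nat -> C) : C :=
  iota (fun l : C_CompleteNormedModule => is_series f l).

Definition Cseries_Z (f : Z -> C) : C :=
  Cseries (fun n => f (Z.of_nat n)) + Cseries (fun n => f (- Z.of_nat (S n))%Z).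

Fixpoint Cprod (f : nat -> C) (n : nat) : C :=
  match n with
  | O => 1
  | S m => Cprod f m * f m
  end.

Definition Cexp (z : C) : C :=
  (exp (Re z) * cos (Im z), exp (Re z) * sin (Im z))%R.

(* e(z) = exp(2 pi i z) *)
Definition e2pi (z : C) : C := Cexp (2 * PI * Ci * z).

(* q^s for complex s: this is e^{2 pi i tau s}, so it depends on tau and not
   only on q. *)
Definition qpow (tau s : C) : C := e2pi (tau * s).

Definition nome (tau : C) : C := e2pi tau.

(* (z; q)_oo *)
Definition qpoch_inf (tau z : C) : C :=
  Cseq_lim (Cprod (fun j => 1 - z * nome tau ^ j)).

(* (z; q)_n for every integer n, negative ones included *)
Definition qpoch (tau z : C) (n : Z) : C :=
  qpoch_inf tau z / qpoch_inf tau (qpow tau (IZR n) * z).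

(* The modified theta function (z, q/z; q)_oo, without the factor (q; q)_oo. *)
Definition theta (tau z : C) : C :=
  qpoch_inf tau z * qpoch_inf tau (nome tau / z).

(* 0phi1(-; b; q, z) *)
Definition phi01 (tau b z : C) : C :=
  Cseries (fun n =>
    qpow tau (INR n * (INR n - 1))
      / (qpoch tau b (Z.of_nat n) * qpoch tau (nome tau) (Z.of_nat n)) * z ^ n).

Definition vartheta11 (tau u : C) : C :=
  Cseries_Z (fun n =>
    Cexp (2 * PI * Ci * (IZR n + 1 / 2) * (u + 1 / 2)
          + PI * Ci * ((IZR n + 1 / 2) * (IZR n + 1 / 2)) * tau)).

(* The generalized Zwegers mu-function in its additive variables; (-1)^n is
   written (-1)^|n|. *)
Definition mu (tau u v alpha : C) : C :=
  Cexp (PI * Ci * alpha * (u - v)) / vartheta11 tau v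
  * Cseries_Z (fun n =>
      (- (1)) ^ Z.abs_nat n
      * e2pi ((IZR n + 1 / 2) * v)
      * qpow tau (IZR n * (IZR n + 1) / 2)
      * (qpoch_inf tau (e2pi u * qpow tau (IZR n + 1))
         / qpoch_inf tau (e2pi u * qpow tau (IZR n - alpha + 1)))).

Definition is_int_qpow (tau z : C) : Prop :=
  exists n : Z, z = qpow tau (IZR n).

(* Main.v *)
Require Import Defs.
From Stdlib Require Import Lra Lia FunctionalExtensionality.

(* Put C = xy/a. Up to explicit factors, mu(xw, yw; a) theta(yw) theta(xw/a) is
   the Poincare series
     H(w) = sum_m (C w^2)^m q^(m(m-1)) P(w q^m),  P(w) = (xw)_oo (qa/(xw))_oo,
   which is holomorphic in w <> 0 and satisfies H(qw) = H(w) / (C w^2). For a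
   monomial P these series span a plane, and by truncating the products in P the
   function H lies in it too. The 2 by 2 determinant of a basis of the plane is a
   multiple of theta(w/p) theta(Cwp), so the values of H at any three points obey
   a linear relation with theta coefficients: this is (i). At w = 1/x and w = a/x
   half of the terms of H vanish, and the remaining one-sided series is turned
   into a 0phi1: this gives (ii) and (iii). *)

(** * Bilateral sums with geometric decay *)

(** The origin of P and of the weight: 1/(xwq^m/a)_oo, which occurs in the summand of mu, equals
    (q^(1-m)a/(xw))_oo / theta(xwq^m/a), and theta(xwq^m/a) is theta(xw/a) times a sign and a
    Gaussian monomial. Pulling theta(xw/a) out removes all poles and raises the weight from
    q^(m(m-1)/2) to q^(m(m-1)). That the solutions of H(qw) = H(w)/(C w^2) form a plane is usually
    read off from Laurent coefficients or from a count of zeros. No holomorphy is used here: every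
    step rearranges dominated bilateral sums or passes to a limit in them. This is possible because
    P(wq^m) and its truncations grow no faster than |q|^(-m^2/2) up to factors exponential in |m|,
    half the rate at which the weight decays, with bounds uniform in the truncation. All
    computations are in logarithmic variables, where multiplication by q is addition of tau; q^alpha
    and (x/y)^(alpha/2) depend on the logarithms anyway. *)

Definition Clim (f : nat -> C) (l : C) : Prop :=
  forall eps : R, (0 < eps)%R ->
  exists N, forall n, (N <= n)%nat -> (Cmod (f n - l) < eps)%R.

(** Coquelicot's balls on C are those of the product of two real lines, not Euclidean discs;
    comparing the two costs the factor sqrt 2. *)
Lemma Clim_filterlim (f : nat -> C) (l : C_CompleteNormedModule) :
  Clim f l <-> filterlim f eventually (locally l).
Proof.
split; intros H.
- apply filterlim_locally; intros eps.
  destruct (H (pos eps) (cond_pos eps)) as [N HN].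
  exists N; intros n Hn.
  apply (C_NormedModule_mixin_compat1 l (f n) (pos eps)). now apply HN.
- intros eps Heps.
  assert (Hs : (0 < sqrt 2)%R) by (apply sqrt_lt_R0; lra).
  assert (He : (0 < eps / sqrt 2)%R) by now apply Rdiv_lt_0_compat.
  destruct (proj1 (filterlim_locally f l) H (mkposreal _ He)) as [N HN].
  exists N; intros n Hn.
  generalize (C_NormedModule_mixin_compat2 l (f n) (mkposreal _ He) (HN n Hn)); simpl.
  replace (sqrt 2 * (eps / sqrt 2))%R with eps by (field; lra). easy.
Qed.

Lemma Clim_unique (f : nat -> C) (l l' : C) : Clim f l -> Clim f l' -> l = l'.
Proof.
intros H H'.
destruct (Req_dec (Cmod (l - l')) 0) as [E|E].
{ apply Cmod_eq_0 in E. replace l with (l - l' + l') by ring. rewrite E; ring. }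
exfalso.
assert (P : (0 < Cmod (l - l'))%R) by (generalize (Cmod_ge_0 (l - l')); lra).
destruct (H (Cmod (l - l') / 2)%R) as [N HN]; [lra|].
destruct (H' (Cmod (l - l') / 2)%R) as [N' HN']; [lra|].
specialize (HN (N + N')%nat ltac:(lia)). specialize (HN' (N + N')%nat ltac:(lia)).
generalize (Cmod_triangle (- (f (N + N')%nat - l)) (f (N + N')%nat - l')).
rewrite Cmod_opp.
replace (- (f (N + N')%nat - l) + (f (N + N')%nat - l')) with (l - l') by ring.
lra.
Qed.

Lemma Clim_ext (f g : nat -> C) (l : C) :
  (forall n, f n = g n) -> Clim f l -> Clim g l.
Proof.
intros E H eps He. destruct (H eps He) as [N HN].
exists N; intros n Hn; rewrite <- E; now apply HN.
Qed.

Lemma Clim_eq (f : nat -> C) (l l' : C) : Clim f l -> l = l' -> Clim f l'.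
Proof. now intros H <-. Qed.

Lemma Clim_const (c : C) : Clim (fun _ => c) c.
Proof.
intros eps He; exists 0%nat; intros n _.
replace (c - c) with (RtoC 0) by ring. now rewrite Cmod_0.
Qed.

Lemma Clim_plus (f g : nat -> C) (l m : C) :
  Clim f l -> Clim g m -> Clim (fun n => f n + g n) (l + m).
Proof.
intros Hf Hg eps He.
destruct (Hf (eps / 2)%R ltac:(lra)) as [N HN].
destruct (Hg (eps / 2)%R ltac:(lra)) as [M HM].
exists (N + M)%nat; intros n Hn.
specialize (HN n ltac:(lia)); specialize (HM n ltac:(lia)).
replace (f n + g n - (l + m)) with ((f n - l) + (g n - m)) by ring.
generalize (Cmod_triangle (f n - l) (g n - m)); lra.
Qed.

Lemma Clim_scal (c : C) (f : nat -> C) (l : C) :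
  Clim f l -> Clim (fun n => c * f n) (c * l).
Proof.
intros Hf eps He.
assert (P := Cmod_ge_0 c).
assert (Q : (0 < eps / (Cmod c + 1))%R) by (apply Rdiv_lt_0_compat; lra).
destruct (Hf _ Q) as [N HN].
exists N; intros n Hn; specialize (HN n Hn).
replace (c * f n - c * l) with (c * (f n - l)) by ring.
rewrite Cmod_mult.
apply Rle_lt_trans with ((Cmod c) * (eps / (Cmod c + 1)))%R.
{ apply Rmult_le_compat_l; lra. }
apply Rlt_le_trans with ((Cmod c + 1) * (eps / (Cmod c + 1)))%R.
{ apply Rmult_lt_compat_r; lra. }
right; field; lra.
Qed.

Lemma Clim_bounded (f : nat -> C) (l : C) :
  Clim f l -> exists K, forall n, (Cmod (f n) <= K)%R.
Proof.
intros H. destruct (H 1%R ltac:(lra)) as [N HN].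
assert (HM : exists M, forall n, (n < N)%nat -> (Cmod (f n) <= M)%R).
{ clear. induction N as [|N [M HM]].
  - exists 0%R; intros n Hn; lia.
  - exists (Rmax M (Cmod (f N))); intros n Hn.
    destruct (Nat.eq_dec n N) as [->|Hne]; [apply Rmax_r|].
    eapply Rle_trans; [apply HM; lia|apply Rmax_l]. }
destruct HM as [M HM].
exists (Rmax M (Cmod l + 1)); intros n.
destruct (Nat.lt_ge_cases n N) as [Hn|Hn].
{ eapply Rle_trans; [now apply HM|apply Rmax_l]. }
eapply Rle_trans; [|apply Rmax_r].
specialize (HN n Hn).
generalize (Cmod_triangle (f n - l) l).
replace (f n - l + l) with (f n) by ring. lra.
Qed.

Lemma Clim_mult (f g : nat -> C) (l m : C) :
  Clim f l -> Clim g m -> Clim (fun n => f n * g n) (l * m).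
Proof.
intros Hf Hg.
assert (H0 : Clim (fun n => f n * (g n - m)) 0).
{ destruct (Clim_bounded _ _ Hf) as [K HK].
  intros eps He.
  assert (P : (0 < Rmax K 0 + 1)%R) by (generalize (Rmax_r K 0); lra).
  destruct (Hg (eps / (Rmax K 0 + 1))%R) as [N HN]; [now apply Rdiv_lt_0_compat|].
  exists N; intros n Hn; specialize (HN n Hn); specialize (HK n).
  replace (f n * (g n - m) - 0) with (f n * (g n - m)) by ring.
  rewrite Cmod_mult.
  apply Rle_lt_trans with ((Rmax K 0) * Cmod (g n - m))%R.
  { apply Rmult_le_compat_r; [apply Cmod_ge_0|].
    eapply Rle_trans; [exact HK|apply Rmax_l]. }
  apply Rle_lt_trans with ((Rmax K 0) * (eps / (Rmax K 0 + 1)))%R.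
  { apply Rmult_le_compat_l; [apply Rmax_r|lra]. }
  apply Rlt_le_trans with ((Rmax K 0 + 1) * (eps / (Rmax K 0 + 1)))%R.
  { apply Rmult_lt_compat_r; [now apply Rdiv_lt_0_compat|lra]. }
  right; field; lra. }
apply Clim_ext with (fun n => f n * (g n - m) + m * f n).
{ intros n; ring. }
replace (l * m) with (0 + m * l) by ring.
apply Clim_plus; [exact H0|now apply Clim_scal].
Qed.

Lemma Clim_subseq (f : nat -> C) (l : C) (phi : nat -> nat) :
  (forall n, (n <= phi n)%nat) -> Clim f l -> Clim (fun n => f (phi n)) l.
Proof.
intros Hphi H eps He. destruct (H eps He) as [N HN].
exists N; intros n Hn. apply HN. specialize (Hphi n); lia.
Qed.

Lemma Clim_le (f : nat -> C) (l : C) (K : R) :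
  Clim f l -> (exists N, forall n, (N <= n)%nat -> (Cmod (f n) <= K)%R) ->
  (Cmod l <= K)%R.
Proof.
intros H [M HM].
apply Rnot_lt_le; intros Hlt.
destruct (H (Cmod l - K)%R ltac:(lra)) as [N HN].
specialize (HN (N + M)%nat ltac:(lia)). specialize (HM (N + M)%nat ltac:(lia)).
generalize (Cmod_triangle (- (f (N + M)%nat - l)) (f (N + M)%nat)).
rewrite Cmod_opp.
replace (- (f (N + M)%nat - l) + f (N + M)%nat) with l by ring. lra.
Qed.

Lemma Cseq_lim_eq (f : nat -> C) (l : C) : Clim f l -> Cseq_lim f = l.
Proof.
intros H. unfold Cseq_lim.
apply (iota_filterlim_locally (V := C_CompleteNormedModule) (F := eventually) f l).
now apply Clim_filterlim.
Qed.

Lemma exp_neg_INR (n : nat) : exp (- INR n) = (exp (-1) ^ n)%R.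
Proof.
induction n as [|n IH].
- simpl. rewrite Ropp_0. apply exp_0.
- rewrite S_INR. replace (- (INR n + 1))%R with (-1 + - INR n)%R by ring.
  rewrite exp_plus, IH. reflexivity.
Qed.

Lemma exp_neg1_bounds : (0 < exp (-1) < 1)%R.
Proof.
split; [apply exp_pos|]. rewrite <- exp_0. apply exp_increasing. lra.
Qed.

(** Since [Cseries] is defined through [iota], it is meaningful only once a limit exists; geometric
    domination provides one, and uniqueness identifies it. *)
Lemma Cseries_correct (f : nat -> C) (K : R) :
  (forall n, (Cmod (f n) <= K * exp (- INR n))%R) ->
  is_series (f : nat -> C_CompleteNormedModule) (Cseries f : C_CompleteNormedModule).
Proof.
intros H.
assert (E : ex_series (f : nat -> C_CompleteNormedModule)).
{ apply ex_series_le with (fun n => (K * exp (-1) ^ n)%R).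
  - intros n. rewrite <- exp_neg_INR. apply (H n).
  - exists (K * / (1 - exp (-1)))%R.
    apply (is_series_scal (K := R_AbsRing) (V := R_NormedModule)).
    apply is_series_geom. destruct exp_neg1_bounds. rewrite Rabs_pos_eq; lra. }
destruct E as [l Hl].
unfold Cseries.
replace (iota _) with (l : C_CompleteNormedModule); [exact Hl|].
symmetry. apply (iota_filterlim_locally (F := eventually) (sum_n (f : nat -> C_CompleteNormedModule)) l Hl).
Qed.

(** * Dominated bilateral sums: translation, reflection, Tannery, Fubini *)

Notation sumZ := Cseries_Z.

(** One fixed decay rate suffices because the infinite series below decay like Gaussians. The
    constant is explicit since Tannery needs it uniform over a family. *)
Definition domK (K : R) (f : Z -> C) : Prop :=
  forall n, (Cmod (f n) <= K * exp (- IZR (Z.abs n)))%R.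

Definition dom (f : Z -> C) : Prop := exists K, domK K f.

(** The window is -N <= n <= N - 1, because [Cseries_Z] pairs the index n with -(n + 1). *)
Fixpoint psum (f : Z -> C) (N : nat) : C :=
  match N with
  | O => 0
  | S n => psum f n + f (Z.of_nat n) + f (- Z.of_nat (S n))%Z
  end.

Lemma psum_halves (f : Z -> C) (N : nat) :
  psum f (S N) =
    (sum_n (fun n => f (Z.of_nat n)) N : C)
    + (sum_n (fun n => f (- Z.of_nat (S n))%Z) N : C).
Proof.
induction N as [|N IH].
- rewrite !sum_O. simpl. ring.
- rewrite !sum_Sn. change (psum f (S (S N))) with
    (psum f (S N) + f (Z.of_nat (S N)) + f (- Z.of_nat (S (S N)))%Z).
  rewrite IH. unfold plus; simpl. ring.
Qed.

Lemma domK_pos (K : R) (f : Z -> C) : domK K f -> (0 <= K)%R.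
Proof.
intros H. specialize (H 0%Z). simpl in H. rewrite Ropp_0, exp_0 in H.
generalize (Cmod_ge_0 (f 0%Z)). lra.
Qed.

Lemma sumZ_correct (f : Z -> C) : dom f -> Clim (psum f) (sumZ f).
Proof.
intros [K H].
assert (H1 : is_series (fun n => f (Z.of_nat n) : C_CompleteNormedModule)
   (Cseries (fun n => f (Z.of_nat n)) : C_CompleteNormedModule)).
{ apply Cseries_correct with K. intros n. specialize (H (Z.of_nat n)).
  rewrite Z.abs_eq in H by lia. now rewrite <- INR_IZR_INZ in H. }
assert (H2 : is_series (fun n => f (- Z.of_nat (S n))%Z : C_CompleteNormedModule)
   (Cseries (fun n => f (- Z.of_nat (S n))%Z) : C_CompleteNormedModule)).
{ apply Cseries_correct with K. intros n.
  eapply Rle_trans; [apply H|].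
  apply Rmult_le_compat_l; [now apply domK_pos with f|].
  rewrite Z.abs_opp, Z.abs_eq by lia. rewrite <- INR_IZR_INZ.
  rewrite S_INR. apply Rlt_le, exp_increasing. lra. }
apply Clim_filterlim in H1. apply Clim_filterlim in H2.
generalize (Clim_plus _ _ _ _ H1 H2). intros H3.
intros eps He. destruct (H3 eps He) as [N HN].
exists (S N). intros [|n] Hn; [lia|].
rewrite psum_halves. apply HN. lia.
Qed.

Lemma sumZ_unique (f : Z -> C) (l : C) : dom f -> Clim (psum f) l -> sumZ f = l.
Proof. intros H. apply Clim_unique. now apply sumZ_correct. Qed.

Lemma psum_ext (f g : Z -> C) (N : nat) : (forall n, f n = g n) -> psum f N = psum g N.
Proof. intros E; induction N as [|N IH]; [easy|]. simpl. now rewrite IH, !E. Qed.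

Lemma dom_ext (f g : Z -> C) : (forall n, f n = g n) -> dom f -> dom g.
Proof. intros E [K H]; exists K; intros n; rewrite <- E; apply H. Qed.

Lemma sumZ_ext (f g : Z -> C) : dom f -> (forall n, f n = g n) -> sumZ f = sumZ g.
Proof.
intros H E. apply sumZ_unique; [easy|].
apply Clim_ext with (psum g); [intros n; now apply psum_ext|].
apply sumZ_correct. now apply dom_ext with f.
Qed.

Lemma dom_plus (f g : Z -> C) : dom f -> dom g -> dom (fun n => f n + g n).
Proof.
intros [K H] [L G]; exists (K + L)%R; intros n.
specialize (H n); specialize (G n).
generalize (Cmod_triangle (f n) (g n)). lra.
Qed.

Lemma dom_scal (c : C) (f : Z -> C) : dom f -> dom (fun n => c * f n).
Proof.
intros [K H]; exists (Cmod c * K)%R; intros n.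
rewrite Cmod_mult, Rmult_assoc. apply Rmult_le_compat_l; [apply Cmod_ge_0|apply H].
Qed.

Lemma sumZ_plus (f g : Z -> C) :
  dom f -> dom g -> sumZ (fun n => f n + g n) = sumZ f + sumZ g.
Proof.
intros H G. apply sumZ_unique; [now apply dom_plus|].
apply Clim_ext with (fun N => psum f N + psum g N).
{ intros N; induction N as [|N IH]; simpl; [ring|]. rewrite <- IH; ring. }
apply Clim_plus; now apply sumZ_correct.
Qed.

Lemma sumZ_scal (c : C) (f : Z -> C) :
  dom f -> sumZ (fun n => c * f n) = c * sumZ f.
Proof.
intros H. apply sumZ_unique; [now apply dom_scal|].
apply Clim_ext with (fun N => c * psum f N).
{ intros N; induction N as [|N IH]; simpl; [ring|]. rewrite <- IH; ring. }
apply Clim_scal; now apply sumZ_correct.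
Qed.

Lemma exp_lim_0 (K eps : R) : (0 < eps)%R ->
  exists N, forall n, (N <= n)%nat -> (K * exp (- INR n) < eps)%R.
Proof.
intros He.
destruct exp_neg1_bounds as [E0 E1].
set (L := (Rabs K + 1)%R).
assert (HL : (0 < L)%R) by (unfold L; generalize (Rabs_pos K); lra).
destruct (pow_lt_1_zero (exp (-1)) ltac:(rewrite Rabs_pos_eq; lra) (eps / L))
  as [N HN]; [now apply Rdiv_lt_0_compat|].
exists N; intros n Hn. specialize (HN n Hn).
rewrite exp_neg_INR.
assert (P : (0 < exp (-1) ^ n)%R) by now apply pow_lt.
rewrite Rabs_pos_eq in HN by lra.
apply Rle_lt_trans with (L * exp (-1) ^ n)%R.
{ apply Rmult_le_compat_r; [lra|]. unfold L. generalize (Rle_abs K). lra. }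
apply Rlt_le_trans with (L * (eps / L))%R.
{ now apply Rmult_lt_compat_l. }
right; field; lra.
Qed.

Lemma dom_lim_0 (f : Z -> C) (phi : nat -> Z) :
  (forall n, (Z.of_nat n <= Z.abs (phi n))%Z) -> dom f -> Clim (fun n => f (phi n)) 0.
Proof.
intros Hphi [K H] eps He.
destruct (exp_lim_0 K eps He) as [N HN].
exists N; intros n Hn. specialize (HN n Hn).
replace (f (phi n) - 0) with (f (phi n)) by ring.
eapply Rle_lt_trans; [|exact HN].
eapply Rle_trans; [apply H|].
apply Rmult_le_compat_l; [now apply domK_pos with f|].
rewrite INR_IZR_INZ. specialize (Hphi n). apply IZR_le in Hphi.
destruct (Rle_lt_or_eq_dec _ _ Hphi) as [Hl|Hl]; [|rewrite Hl; lra].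
apply Rlt_le, exp_increasing. lra.
Qed.

Lemma dom_comp (f : Z -> C) (phi : Z -> Z) (d : Z) :
  (forall n, (Z.abs n <= Z.abs (phi n) + d)%Z) -> dom f -> dom (fun n => f (phi n)).
Proof.
intros Hphi [K H]. exists (K * exp (IZR d))%R. intros n.
eapply Rle_trans; [apply H|]. rewrite Rmult_assoc, <- exp_plus.
apply Rmult_le_compat_l; [now apply domK_pos with f|].
specialize (Hphi n). apply IZR_le in Hphi. rewrite plus_IZR in Hphi.
destruct (Rle_lt_or_eq_dec _ _ Hphi) as [Hl|Hl].
- apply Rlt_le, exp_increasing. lra.
- right; f_equal; lra.
Qed.

Lemma dom_shift (f : Z -> C) (k : Z) : dom f -> dom (fun n => f (n + k)%Z).
Proof. apply (dom_comp f (fun n => n + k)%Z (Z.abs k)). intros n; lia. Qed.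

Lemma dom_opp (f : Z -> C) : dom f -> dom (fun n => f (- n)%Z).
Proof. apply (dom_comp f (fun n => - n)%Z 0%Z). intros n; lia. Qed.

(** [g N] is the sum over the window -N + 1 <= n <= N. Translation by one and reflection both turn
    the window of [psum] into this one, so the lemma serves [sumZ_succ] and [sumZ_opp] alike. *)
Lemma Clim_psum_perturbed (f : Z -> C) (g : nat -> C) :
  dom f ->
  (forall N, g N = psum f N + f (Z.of_nat N) - f (- Z.of_nat N)%Z) -> Clim g (sumZ f).
Proof.
intros H E.
apply Clim_ext with (fun N => psum f N + (f (Z.of_nat N) + (- (1)) * f (- Z.of_nat N)%Z)).
{ intros N; rewrite E; ring. }
replace (sumZ f) with (sumZ f + (0 + (- (1)) * 0)) by ring.
apply Clim_plus; [now apply sumZ_correct|].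
apply Clim_plus; [|apply Clim_scal]; apply dom_lim_0; auto; intros n; lia.
Qed.

Lemma sumZ_succ (f : Z -> C) : dom f -> sumZ (fun n => f (n + 1)%Z) = sumZ f.
Proof.
intros H. apply sumZ_unique; [now apply dom_shift|].
apply Clim_psum_perturbed; [easy|].
intros N; induction N as [|N IH]; [simpl; ring|].
cbn [psum]. rewrite IH.
replace (- Z.of_nat (S N) + 1)%Z with (- Z.of_nat N)%Z by lia.
replace (Z.of_nat N + 1)%Z with (Z.of_nat (S N))%Z by lia. ring.
Qed.

Lemma sumZ_shift (f : Z -> C) (k : Z) : dom f -> sumZ (fun n => f (n + k)%Z) = sumZ f.
Proof.
intros H.
assert (Hnat : forall (g : Z -> C) (j : nat), dom g ->
          sumZ (fun n => g (n + Z.of_nat j)%Z) = sumZ g).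
{ intros g j Hg; induction j as [|j IH].
  - apply sumZ_ext; [now apply dom_shift|]. intros n; f_equal; lia.
  - rewrite <- IH. rewrite <- (sumZ_succ (fun n => g (n + Z.of_nat j)%Z)) by now apply dom_shift.
    apply sumZ_ext; [now apply dom_shift|]. intros n; f_equal; lia. }
destruct (Z.le_ge_cases 0 k) as [Hk|Hk].
- rewrite <- (Hnat f (Z.to_nat k)) by easy.
  apply sumZ_ext; [now apply dom_shift|]. intros n; f_equal; lia.
- rewrite <- (Hnat (fun n => f (n + k)%Z) (Z.to_nat (- k))) by now apply dom_shift.
  apply sumZ_ext; [|intros n; f_equal; lia].
  apply (dom_comp f (fun n => (n + Z.of_nat (Z.to_nat (- k)) + k)%Z) 0%Z); [intros n; lia|easy].
Qed.

Lemma sumZ_opp (f : Z -> C) : dom f -> sumZ (fun n => f (- n)%Z) = sumZ f.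
Proof.
intros H. apply sumZ_unique; [now apply dom_opp|].
apply Clim_psum_perturbed; [easy|].
intros N; induction N as [|N IH]; [simpl; ring|].
cbn [psum]. rewrite IH.
rewrite Z.opp_involutive. ring.
Qed.

(** The right side telescopes: step p adds at most 2 K e^(-p), and e^(-p) - e^(-p-1) = (1 - e^(-1))
    e^(-p). *)
Lemma psum_increment_bound (K : R) (f : Z -> C) (M n : nat) : domK K f ->
  (Cmod (psum f (M + n) - psum f M) <=
     K * (2 / (1 - exp (-1))) * (exp (- INR M) - exp (- INR (M + n))))%R.
Proof.
intros H. assert (HK := domK_pos _ _ H). destruct exp_neg1_bounds as [E0 E1].
induction n as [|n IH].
- rewrite Nat.add_0_r. replace (psum f M - psum f M) with (RtoC 0) by ring.
  rewrite Cmod_0. lra.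
- rewrite Nat.add_succ_r. cbn [psum]. set (p := (M + n)%nat) in *.
  replace (psum f p + f (Z.of_nat p) + f (- Z.of_nat (S p))%Z - psum f M)
    with ((psum f p - psum f M) + (f (Z.of_nat p) + f (- Z.of_nat (S p))%Z)) by ring.
  eapply Rle_trans; [apply Cmod_triangle|].
  assert (A : (Cmod (f (Z.of_nat p) + f (- Z.of_nat (S p))%Z) <= K * 2 * exp (- INR p))%R).
  { eapply Rle_trans; [apply Cmod_triangle|].
    assert (A1 := H (Z.of_nat p)). assert (A2 := H (- Z.of_nat (S p))%Z).
    rewrite Z.abs_opp in A2. rewrite Z.abs_eq, <- INR_IZR_INZ in A1, A2 by lia.
    assert (exp (- INR (S p)) <= exp (- INR p))%R.
    { apply Rlt_le, exp_increasing. rewrite S_INR. lra. }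
    assert (K * exp (- INR (S p)) <= K * exp (- INR p))%R by now apply Rmult_le_compat_l.
    lra. }
  assert (B : exp (- INR (S p)) = (exp (-1) * exp (- INR p))%R).
  { rewrite S_INR, <- exp_plus. f_equal; ring. }
  rewrite B.
  replace (K * (2 / (1 - exp (-1))) * (exp (- INR M) - exp (-1) * exp (- INR p)))%R
    with (K * (2 / (1 - exp (-1))) * (exp (- INR M) - exp (- INR p)) + K * 2 * exp (- INR p))%R
    by (field; lra).
  lra.
Qed.

Lemma sumZ_tail (K : R) (f : Z -> C) (M : nat) : domK K f ->
  (Cmod (sumZ f - psum f M) <= K * (2 / (1 - exp (-1))) * exp (- INR M))%R.
Proof.
intros H. assert (HK := domK_pos _ _ H). destruct exp_neg1_bounds as [E0 E1].
apply Clim_le with (fun N => psum f N - psum f M).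
- apply Clim_ext with (fun N => psum f N + - psum f M); [intros; ring|].
  replace (sumZ f - psum f M) with (sumZ f + - psum f M) by ring.
  apply Clim_plus; [apply sumZ_correct; now exists K|apply Clim_const].
- exists M; intros n Hn. replace n with (M + (n - M))%nat by lia.
  eapply Rle_trans; [now apply psum_increment_bound|].
  apply Rmult_le_compat_l.
  + apply Rmult_le_pos; [easy|]. apply Rlt_le, Rdiv_lt_0_compat; lra.
  + generalize (exp_pos (- INR (M + (n - M)))). lra.
Qed.

Lemma sumZ_bound (K : R) (f : Z -> C) : domK K f ->
  (Cmod (sumZ f) <= K * (2 / (1 - exp (-1))))%R.
Proof.
intros H. generalize (sumZ_tail K f 0 H). simpl.
rewrite Ropp_0, exp_0, Rmult_1_r.
replace (sumZ f - 0) with (sumZ f) by ring. easy.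
Qed.

Lemma Clim_psum (F : nat -> Z -> C) (f : Z -> C) (M : nat) :
  (forall n, Clim (fun N => F N n) (f n)) -> Clim (fun N => psum (F N) M) (psum f M).
Proof.
intros H. induction M as [|M IH]; simpl; [apply Clim_const|].
apply Clim_plus; [apply Clim_plus|]; auto.
Qed.

(** Beyond M the tails are small uniformly in N, and the finitely many terms before M converge. The
    domination of the limit is part of the conclusion because the limit series has to be manipulated
    as well. *)
Lemma tannery (K : R) (F : nat -> Z -> C) (f : Z -> C) :
  (forall N, domK K (F N)) -> (forall n, Clim (fun N => F N n) (f n)) ->
  domK K f /\ Clim (fun N => sumZ (F N)) (sumZ f).
Proof.
intros HF Hlim.
assert (Hf : domK K f).
{ intros n. apply Clim_le with (fun N => F N n); [easy|]. exists 0%nat; intros N _; apply HF. }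
split; [easy|].
intros eps He.
destruct (exp_lim_0 (K * (2 / (1 - exp (-1)))) (eps / 4) ltac:(lra)) as [M HM].
specialize (HM M (Nat.le_refl M)).
destruct (Clim_psum F f M Hlim (eps / 4)%R ltac:(lra)) as [N HN].
exists N; intros n Hn. specialize (HN n Hn).
assert (T1 := sumZ_tail K (F n) M (HF n)). assert (T2 := sumZ_tail K f M Hf).
replace (sumZ (F n) - sumZ f) with
  ((sumZ (F n) - psum (F n) M) + ((psum (F n) M - psum f M) + - (sumZ f - psum f M))) by ring.
eapply Rle_lt_trans; [apply Cmod_triangle|].
generalize (Cmod_triangle (psum (F n) M - psum f M) (- (sumZ f - psum f M))).
rewrite Cmod_opp. lra.
Qed.

Lemma psum_dom (f : Z -> Z -> C) (J : nat) :
  (forall j, dom (fun m => f m j)) -> dom (fun m => psum (f m) J).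
Proof.
intros H. induction J as [|J IH]; simpl.
- exists 0%R; intros m. rewrite Cmod_0. lra.
- apply dom_plus; [apply dom_plus|]; auto.
Qed.

Lemma sumZ_psum (f : Z -> Z -> C) (J : nat) :
  (forall j, dom (fun m => f m j)) ->
  sumZ (fun m => psum (f m) J) = psum (fun j => sumZ (fun m => f m j)) J.
Proof.
intros H. induction J as [|J IH]; cbn [psum].
- apply sumZ_unique.
  + exists 0%R; intros m. rewrite Cmod_0. lra.
  + apply Clim_ext with (fun _ => 0); [|apply Clim_const].
    intros N; induction N as [|N IH]; [easy|]. simpl. rewrite <- IH. ring.
- rewrite !sumZ_plus, IH; auto.
  + now apply psum_dom.
  + apply dom_plus; [now apply psum_dom|auto].
Qed.

Lemma dom_sumZ (K : R) (f : Z -> Z -> C) :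
  (forall m j, (Cmod (f m j) <= K * exp (- IZR (Z.abs m)) * exp (- IZR (Z.abs j)))%R) ->
  dom (fun j => sumZ (fun m => f m j)).
Proof.
intros H. exists (K * (2 / (1 - exp (-1))))%R. intros j.
assert (H2 : domK (K * exp (- IZR (Z.abs j))) (fun m => f m j)).
{ intros m. eapply Rle_trans; [apply H|]. right; ring. }
eapply Rle_trans; [apply (sumZ_bound _ _ H2)|]. right; ring.
Qed.

(** Finite sums over j commute with the sum over m; Tannery, applied to the partial sums over j,
    passes to the limit. *)
Lemma fubini_sumZ (K : R) (f : Z -> Z -> C) :
  (forall m j, (Cmod (f m j) <= K * exp (- IZR (Z.abs m)) * exp (- IZR (Z.abs j)))%R) ->
  sumZ (fun m => sumZ (fun j => f m j)) = sumZ (fun j => sumZ (fun m => f m j)).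
Proof.
intros H. destruct exp_neg1_bounds as [E0 E1].
assert (HK : (0 <= K)%R).
{ specialize (H 0%Z 0%Z). simpl in H. rewrite Ropp_0, exp_0 in H.
  generalize (Cmod_ge_0 (f 0%Z 0%Z)). lra. }
assert (H1 : forall m, domK (K * exp (- IZR (Z.abs m))) (f m)) by (intros m j; apply H).
assert (H2 : forall j, domK (K * exp (- IZR (Z.abs j))) (fun m => f m j)).
{ intros j m. eapply Rle_trans; [apply H|]. right; ring. }
set (c := (2 / (1 - exp (-1)))%R).
assert (Hc : (0 < c)%R) by (apply Rdiv_lt_0_compat; lra).
symmetry. apply sumZ_unique.
- now apply dom_sumZ with K.
- apply Clim_ext with (fun J => sumZ (fun m => psum (f m) J)).
  { intros J; apply sumZ_psum. intros j; eexists; apply H2. }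
  apply (tannery (K * c)).
  + intros J m.
    generalize (psum_increment_bound _ _ 0 J (H1 m)). simpl psum.
    replace (psum (f m) J - 0) with (psum (f m) J) by ring. rewrite Nat.add_0_l.
    intros A. eapply Rle_trans; [apply A|]. fold c.
    simpl INR. rewrite Ropp_0, exp_0.
    assert (B := exp_pos (- INR J)). assert (B' := exp_pos (- IZR (Z.abs m))).
    assert (0 <= K * exp (- IZR (Z.abs m)) * c)%R
      by (apply Rmult_le_pos; [apply Rmult_le_pos|]; lra).
    nra.
  + intros m. apply sumZ_correct. eexists; apply H1.
Qed.

(** The window from -2N to 2N - 1 consists exactly of the numbers 2i and 2i + 1 with i in the window
    from -N to N - 1, so partial sums match along a subsequence. *)
Lemma sumZ_even_odd (f : Z -> C) : dom f ->
  sumZ f = sumZ (fun i => f (2 * i)%Z) + sumZ (fun i => f (2 * i + 1)%Z).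
Proof.
intros H.
assert (D0 : dom (fun i => f (2 * i)%Z)).
{ apply (dom_comp f (fun i => 2 * i)%Z 0%Z); [intros; lia|easy]. }
assert (D1 : dom (fun i => f (2 * i + 1)%Z)).
{ apply (dom_comp f (fun i => 2 * i + 1)%Z 1%Z); [intros; lia|easy]. }
apply Clim_unique with (fun N => psum f (2 * N)).
- apply (Clim_subseq (psum f) _ (fun N => 2 * N)%nat); [intros; lia|now apply sumZ_correct].
- apply Clim_ext with
    (fun N => psum (fun i => f (2 * i)%Z) N + psum (fun i => f (2 * i + 1)%Z) N).
  + intros N; induction N as [|N IH]; [simpl; ring|].
    replace (2 * S N)%nat with (S (S (2 * N))) by lia. cbn [psum]. rewrite <- IH.
    replace (2 * - Z.of_nat (S N) + 1)%Z with (- Z.of_nat (S (2 * N)))%Z by lia.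
    replace (2 * - Z.of_nat (S N))%Z with (- Z.of_nat (S (S (2 * N))))%Z by lia.
    replace (2 * Z.of_nat N)%Z with (Z.of_nat (2 * N))%Z by lia.
    replace (Z.of_nat (2 * N) + 1)%Z with (Z.of_nat (S (2 * N)))%Z by lia. ring.
  + apply Clim_plus; now apply sumZ_correct.
Qed.

Lemma sumZ_finite0 (f : Z -> C) : (forall n, n <> 0%Z -> f n = 0) -> sumZ f = f 0%Z.
Proof.
intros H. apply sumZ_unique.
- exists (Cmod (f 0%Z)). intros n.
  destruct (Z.eq_dec n 0) as [->|Hn].
  + simpl. rewrite Ropp_0, exp_0. lra.
  + rewrite H, Cmod_0 by easy. apply Rmult_le_pos; [apply Cmod_ge_0|apply Rlt_le, exp_pos].
- intros eps He; exists 1%nat; intros n Hn.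
  replace (psum f n) with (f 0%Z).
  + replace (f 0%Z - f 0%Z) with (RtoC 0) by ring. now rewrite Cmod_0.
  + destruct n as [|n]; [lia|]. clear Hn. induction n as [|n IH].
    * simpl. rewrite (H (-1)%Z) by easy. ring.
    * change (psum f (S (S n))) with
        (psum f (S n) + f (Z.of_nat (S n)) + f (- Z.of_nat (S (S n)))%Z).
      rewrite <- IH, (H (Z.of_nat (S n))), (H (- Z.of_nat (S (S n)))%Z) by lia. ring.
Qed.

(** * The exponential and the infinite product *)

Lemma exp_le (a b : R) : (a <= b)%R -> (exp a <= exp b)%R.
Proof.
intros [H|H]; [now apply Rlt_le, exp_increasing|rewrite H; lra].
Qed.

Lemma Cexp_plus (z w : C) : Cexp (z + w) = Cexp z * Cexp w.
Proof.
destruct z as [a b], w as [c d]. unfold Cexp; simpl.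
rewrite exp_plus, cos_plus, sin_plus. apply injective_projections; simpl; ring.
Qed.

Lemma Cmod_Cexp (z : C) : Cmod (Cexp z) = exp (Re z).
Proof.
unfold Cmod, Cexp. cbn [fst snd].
transitivity (sqrt (exp (Re z) ^ 2)); [f_equal|apply sqrt_pow2, Rlt_le, exp_pos].
generalize (sin2_cos2 (Im z)). unfold Rsqr. intros S.
transitivity (exp (Re z) ^ 2 * (sin (Im z) * sin (Im z) + cos (Im z) * cos (Im z)))%R; [ring|].
rewrite S. ring.
Qed.

Lemma e2pi_plus (z w : C) : e2pi (z + w) = e2pi z * e2pi w.
Proof. unfold e2pi. rewrite <- Cexp_plus. f_equal. ring. Qed.

Lemma Cmod_e2pi (z : C) : Cmod (e2pi z) = exp (- (2 * PI * Im z)).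
Proof. unfold e2pi. rewrite Cmod_Cexp. f_equal. destruct z; simpl. ring. Qed.

Lemma e2pi_neq_0 (z : C) : e2pi z <> 0.
Proof. apply Cmod_gt_0. rewrite Cmod_e2pi. apply exp_pos. Qed.

Lemma e2pi_0 : e2pi 0 = 1.
Proof.
unfold e2pi, Cexp. apply injective_projections; simpl.
- replace (_ * 0 - _ * 0)%R with 0%R by ring.
  replace (_ * 0 + _ * 0)%R with 0%R by ring. rewrite exp_0, cos_0. ring.
- replace (_ * 0 + _ * 0)%R with 0%R by ring. rewrite sin_0. ring.
Qed.

Lemma e2pi_opp (z : C) : e2pi (- z) = / e2pi z.
Proof.
assert (H : e2pi (- z) * e2pi z = 1).
{ rewrite <- e2pi_plus, <- e2pi_0. f_equal. ring. }
assert (N := e2pi_neq_0 z).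
replace (/ e2pi z) with (e2pi (- z) * e2pi z * / e2pi z) by (rewrite H; ring).
field. exact N.
Qed.

Lemma e2pi_minus (z w : C) : e2pi (z - w) = e2pi z / e2pi w.
Proof. unfold Cminus. now rewrite e2pi_plus, e2pi_opp. Qed.

Lemma e2pi_half : e2pi (1 / 2) = - (1).
Proof.
unfold e2pi, Cexp.
replace (2 * PI * Ci * (1 / 2)) with (Ci * PI) by field.
apply injective_projections; simpl.
- replace (0 * PI - 1 * 0)%R with 0%R by ring.
  replace (0 * 0 + 1 * PI)%R with PI by ring. rewrite exp_0, cos_PI. ring.
- replace (0 * 0 + 1 * PI)%R with PI by ring. rewrite sin_PI. ring.
Qed.

Lemma e2pi_quarter : e2pi (1 / 4) = Ci.
Proof.
unfold e2pi, Cexp.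
replace (2 * PI * Ci * (1 / 4)) with (Ci * (PI / 2)%R).
2:{ rewrite RtoC_div by lra. field. }
apply injective_projections; simpl.
- replace (0 * (PI / 2) - 1 * 0)%R with 0%R by ring.
  replace (0 * 0 + 1 * (PI / 2))%R with (PI / 2)%R by ring.
  rewrite exp_0, cos_PI2. ring.
- replace (0 * (PI / 2) - 1 * 0)%R with 0%R by ring.
  replace (0 * 0 + 1 * (PI / 2))%R with (PI / 2)%R by ring.
  rewrite exp_0, sin_PI2. ring.
Qed.

Lemma e2pi_1 : e2pi 1 = 1.
Proof.
replace (RtoC 1) with (1 / 2 + 1 / 2) at 1 by field.
rewrite e2pi_plus, e2pi_half. ring.
Qed.

Lemma e2pi_INR (z : C) (n : nat) : e2pi (INR n * z) = e2pi z ^ n.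
Proof.
induction n as [|n IH].
- simpl. replace (0 * z) with (RtoC 0) by ring. apply e2pi_0.
- rewrite S_INR, RtoC_plus. replace ((INR n + 1) * z) with (z + INR n * z) by ring.
  rewrite e2pi_plus, IH. reflexivity.
Qed.

Lemma e2pi_IZR (n : Z) : e2pi (IZR n) = 1.
Proof.
assert (H : forall k : nat, e2pi (INR k) = 1).
{ intros k. replace (RtoC (INR k)) with (INR k * 1) by ring.
  rewrite e2pi_INR, e2pi_1. induction k as [|k IH]; [easy|]. simpl. rewrite IH. ring. }
destruct (Z.le_ge_cases 0 n) as [Hn|Hn].
- rewrite <- (Z2Nat.id n) by easy. rewrite <- INR_IZR_INZ. apply H.
- replace n with (- Z.of_nat (Z.to_nat (- n)))%Z by lia.
  rewrite opp_IZR, <- INR_IZR_INZ, RtoC_opp, e2pi_opp, H. field.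
Qed.

Lemma e2pi_eq_mod_1 (n : Z) (z w : C) : z = w + IZR n -> e2pi z = e2pi w.
Proof. intros ->. rewrite e2pi_plus, e2pi_IZR. ring. Qed.

Lemma sign_e2pi (n : Z) : (- (1)) ^ Z.abs_nat n = e2pi (IZR n / 2).
Proof.
destruct (Z.le_ge_cases 0 n) as [Hn|Hn].
- rewrite <- (Z2Nat.id n) by easy. rewrite <- INR_IZR_INZ, Zabs2Nat.id.
  replace (INR (Z.to_nat n) / 2) with (INR (Z.to_nat n) * (1 / 2)) by field.
  now rewrite e2pi_INR, e2pi_half.
- replace n with (- Z.of_nat (Z.to_nat (- n)))%Z by lia.
  rewrite opp_IZR, <- INR_IZR_INZ.
  replace (Z.abs_nat (- Z.of_nat (Z.to_nat (- n)))) with (Z.to_nat (- n)) by lia.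
  set (k := Z.to_nat (- n)).
  replace ((- INR k)%R / 2) with (INR k * (1 / 2 - 1)) by (rewrite RtoC_opp; field).
  rewrite e2pi_INR, e2pi_minus, e2pi_half, e2pi_1. f_equal. field.
Qed.

Lemma e2pi_half_shift (z : C) : e2pi (z + 1 / 2) = - e2pi z.
Proof. rewrite e2pi_plus, e2pi_half. ring. Qed.

(* The Gaussian weight dominates: -eps t^2 + b t <= -t + (b+1)^2/(4 eps). *)
Lemma domK_gauss (c b eps : R) (f : Z -> C) :
  (0 < eps)%R ->
  (forall n, Cmod (f n) <= exp (c + b * IZR (Z.abs n) - eps * (IZR n * IZR n)))%R ->
  domK (exp (c + (b + 1) * (b + 1) / (4 * eps))) f.
Proof.
intros He H n. eapply Rle_trans; [apply H|].
rewrite <- exp_plus.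
set (t := IZR (Z.abs n)).
assert (E : (IZR n * IZR n = t * t)%R).
{ unfold t. rewrite abs_IZR. now rewrite <- Rabs_mult, Rabs_pos_eq by apply Rle_0_sqr. }
rewrite E.
assert (S : (0 <= (t * (2 * eps) - (b + 1)) * (t * (2 * eps) - (b + 1)) / (4 * eps))%R).
{ apply Rmult_le_pos; [apply Rle_0_sqr|]. apply Rlt_le, Rinv_0_lt_compat. lra. }
replace ((t * (2 * eps) - (b + 1)) * (t * (2 * eps) - (b + 1)) / (4 * eps))%R with
  (eps * (t * t) - t * (b + 1) + (b + 1) * (b + 1) / (4 * eps))%R in S by (field; lra).
apply exp_le. lra.
Qed.

Lemma Cmod_e2pi_quad (c0 c1 c2 : C) (n : Z) :
  (Cmod (e2pi (c0 + IZR n * c1 + IZR n * IZR n * c2)) <=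
     exp (Rabs (2 * PI * Im c0) + Rabs (2 * PI * Im c1) * IZR (Z.abs n)
          - 2 * PI * Im c2 * (IZR n * IZR n)))%R.
Proof.
rewrite Cmod_e2pi. apply exp_le.
replace (Im (c0 + IZR n * c1 + IZR n * IZR n * c2)) with
  (Im c0 + IZR n * Im c1 + IZR n * IZR n * Im c2)%R
  by (destruct c0, c1, c2; simpl; ring).
assert (A := Rle_abs (- (2 * PI * Im c0))). rewrite Rabs_Ropp in A.
assert (B := Rle_abs (- (2 * PI * Im c1 * IZR n))). rewrite Rabs_Ropp, Rabs_mult in B.
rewrite abs_IZR. lra.
Qed.

(* [d] bounds the quadratic growth rate of the factor [g]. *)
Lemma domK_quad (c0 c1 c2 : C) (c b d : R) :
  (d < 2 * PI * Im c2)%R ->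
  exists K, forall (f g : Z -> C),
    (forall n, Cmod (g n) <= exp (c + b * IZR (Z.abs n) + d * (IZR n * IZR n)))%R ->
    (forall n, f n = e2pi (c0 + IZR n * c1 + IZR n * IZR n * c2) * g n) ->
    domK K f.
Proof.
intros Hd. eexists. intros f g Hg Hf.
apply (domK_gauss (Rabs (2 * PI * Im c0) + c) (Rabs (2 * PI * Im c1) + b)
         (2 * PI * Im c2 - d)); [lra|].
intros n. rewrite Hf, Cmod_mult.
eapply Rle_trans.
{ apply Rmult_le_compat; try apply Cmod_ge_0; [apply Cmod_e2pi_quad|apply Hg]. }
rewrite <- exp_plus. apply exp_le. lra.
Qed.

(** * Growth, zeros and limits of the infinite product *)

Section Poch.
Variable tau : C.
Hypothesis Htau : (0 < Im tau)%R.

Let r := exp (- (2 * PI * Im tau)).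

Lemma r_bounds : (0 < r < 1)%R.
Proof.
split; [apply exp_pos|]. rewrite <- exp_0. apply exp_increasing.
assert (P := PI_RGT_0). nra.
Qed.

Definition poch_trunc (N : nat) (z : C) : C := Cprod (fun j => 1 - e2pi z * nome tau ^ j) N.
Definition poch_add (z : C) : C := qpoch_inf tau (e2pi z).

Lemma nome_pow (j : nat) : nome tau ^ j = e2pi (INR j * tau).
Proof. unfold nome. now rewrite e2pi_INR. Qed.

Lemma poch_trunc_S (N : nat) (z : C) : poch_trunc (S N) z = poch_trunc N z * (1 - e2pi (z + INR N * tau)).
Proof. unfold poch_trunc. simpl. now rewrite nome_pow, e2pi_plus. Qed.

Lemma poch_trunc_head (N : nat) (z : C) : poch_trunc (S N) z = (1 - e2pi z) * poch_trunc N (z + tau).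
Proof.
induction N as [|N IH].
- rewrite poch_trunc_S. unfold poch_trunc; simpl. replace (z + 0 * tau) with z by ring. ring.
- rewrite poch_trunc_S, IH, poch_trunc_S. rewrite S_INR, RtoC_plus.
  replace (z + (INR N + 1) * tau) with (z + tau + INR N * tau) by ring. ring.
Qed.

Lemma Cmod_factor (z : C) (N : nat) : (Cmod (e2pi (z + INR N * tau)) = Cmod (e2pi z) * r ^ N)%R.
Proof.
rewrite e2pi_plus, e2pi_INR, Cmod_mult, Cmod_pow. now rewrite (Cmod_e2pi tau).
Qed.

(** The factor with index j is at most exp(|z| r^j) with r = |q|; the exponents form a geometric
    sum, kept in closed form for the induction. *)
Lemma poch_trunc_bound_geom (N : nat) (z : C) :
  (Cmod (poch_trunc N z) <= exp (Cmod (e2pi z) * ((1 - r ^ N) / (1 - r))))%R.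
Proof.
destruct r_bounds as [R0 R1].
induction N as [|N IH].
- unfold poch_trunc; simpl. rewrite Cmod_1.
  replace (_ * _)%R with 0%R by (field; lra). rewrite exp_0; lra.
- rewrite poch_trunc_S, Cmod_mult.
  replace (Cmod (e2pi z) * ((1 - r ^ S N) / (1 - r)))%R with
    (Cmod (e2pi z) * ((1 - r ^ N) / (1 - r)) + Cmod (e2pi z) * r ^ N)%R
    by (simpl; field; lra).
  rewrite exp_plus. apply Rmult_le_compat; try apply Cmod_ge_0; [easy|].
  eapply Rle_trans; [|apply exp_ineq1_le].
  unfold Cminus. eapply Rle_trans; [apply Cmod_triangle|].
  rewrite Cmod_opp, Cmod_1, Cmod_factor. lra.
Qed.

Lemma poch_trunc_bound (N : nat) (z : C) :
  (Cmod (poch_trunc N z) <= exp (Cmod (e2pi z) / (1 - r)))%R.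
Proof.
destruct r_bounds as [R0 R1].
eapply Rle_trans; [apply poch_trunc_bound_geom|]. apply exp_le.
apply Rmult_le_compat_l; [apply Cmod_ge_0|].
assert (0 < / (1 - r))%R by (apply Rinv_0_lt_compat; lra).
assert (0 < r ^ N)%R by now apply pow_lt.
unfold Rdiv. nra.
Qed.

Lemma poch_trunc_increment (M n : nat) (z : C) :
  (Cmod (poch_trunc (M + n) z - poch_trunc M z) <=
     exp (Cmod (e2pi z) / (1 - r)) * Cmod (e2pi z) * ((r ^ M - r ^ (M + n)) / (1 - r)))%R.
Proof.
destruct r_bounds as [R0 R1].
induction n as [|n IH].
- rewrite Nat.add_0_r. replace (poch_trunc M z - poch_trunc M z) with (RtoC 0) by ring.
  rewrite Cmod_0. right; field; lra.
- rewrite Nat.add_succ_r, poch_trunc_S. set (p := (M + n)%nat) in *.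
  replace (poch_trunc p z * (1 - e2pi (z + INR p * tau)) - poch_trunc M z) with
    ((poch_trunc p z - poch_trunc M z) + - (poch_trunc p z * e2pi (z + INR p * tau))) by ring.
  eapply Rle_trans; [apply Cmod_triangle|].
  rewrite Cmod_opp, Cmod_mult, Cmod_factor.
  assert (B := poch_trunc_bound p z).
  assert (P : (0 <= Cmod (e2pi z) * r ^ p)%R).
  { apply Rmult_le_pos; [apply Cmod_ge_0|]. now apply Rlt_le, pow_lt. }
  assert (Q := Rmult_le_compat_r _ _ _ P B).
  set (X := exp (Cmod (e2pi z) / (1 - r))) in *.
  replace (X * Cmod (e2pi z) * ((r ^ M - r ^ S p) / (1 - r)))%R with
    (X * Cmod (e2pi z) * ((r ^ M - r ^ p) / (1 - r)) + X * (Cmod (e2pi z) * r ^ p))%R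
    by (simpl; field; lra).
  lra.
Qed.

Lemma poch_add_lim (z : C) : Clim (fun N => poch_trunc N z) (poch_add z).
Proof.
destruct r_bounds as [R0 R1].
assert (E : exists l, Clim (fun N => poch_trunc N z) l).
(* A limit is obtained by summing the increments, which are dominated by a geometric series. *)
{ set (d := fun n => (poch_trunc (S n) z - poch_trunc n z : C_CompleteNormedModule)).
  assert (E : ex_series d).
  { apply ex_series_le with (fun n => (exp (Cmod (e2pi z) / (1 - r)) * Cmod (e2pi z) * r ^ n)%R).
    - intros n. generalize (poch_trunc_increment n 1 z). rewrite Nat.add_1_r.
      intros H. eapply Rle_trans; [apply H|]. right. simpl. field. lra.
    - eexists. apply (is_series_scal (K := R_AbsRing) (V := R_NormedModule)).
      apply is_series_geom. rewrite Rabs_pos_eq; lra. }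
  destruct E as [l Hl]. apply Clim_filterlim in Hl.
  exists (1 + l).
  assert (Hs : forall n, (1 + (sum_n d n : C))%C = poch_trunc (S n) z).
  { induction n as [|n IH].
    - rewrite sum_O. unfold d. unfold poch_trunc at 2. simpl. ring.
    - rewrite sum_Sn. unfold plus; simpl.
      replace (1 + (Cplus (sum_n d n) (d (S n)))) with ((1 + (sum_n d n : C)) + d (S n)) by ring.
      rewrite IH. unfold d. ring. }
  intros eps He. destruct (Clim_plus _ _ _ _ (Clim_const 1) Hl eps He) as [N HN].
  exists (S N). intros [|n] Hn; [lia|]. rewrite <- Hs. apply HN. lia. }
destruct E as [l Hl].
replace (poch_add z) with l; [easy|]. symmetry. now apply Cseq_lim_eq.
Qed.

Lemma poch_add_step (z : C) : poch_add z = (1 - e2pi z) * poch_add (z + tau).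
Proof.
apply Clim_unique with (fun N => poch_trunc (S N) z).
- apply (Clim_subseq (fun N => poch_trunc N z) _ S); [lia|apply poch_add_lim].
- apply Clim_ext with (fun N => (1 - e2pi z) * poch_trunc N (z + tau)).
  + intros N; now rewrite poch_trunc_head.
  + apply Clim_scal, poch_add_lim.
Qed.

Lemma poch_add_bound (z : C) : (Cmod (poch_add z) <= exp (Cmod (e2pi z) / (1 - r)))%R.
Proof.
apply Clim_le with (fun N => poch_trunc N z); [apply poch_add_lim|].
exists 0%nat; intros; apply poch_trunc_bound.
Qed.

Lemma poch_add_near_1 (z : C) :
  (Cmod (poch_add z - 1) <= exp (Cmod (e2pi z) / (1 - r)) * Cmod (e2pi z) / (1 - r))%R.
Proof.
destruct r_bounds as [R0 R1].
apply Clim_le with (fun N => poch_trunc N z - 1).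
- apply Clim_ext with (fun N => poch_trunc N z + - (1)); [intros; ring|].
  replace (poch_add z - 1) with (poch_add z + - (1)) by ring.
  apply Clim_plus; [apply poch_add_lim|apply Clim_const].
- exists 0%nat; intros n _. generalize (poch_trunc_increment 0 n z). simpl.
  change (poch_trunc 0 z) with (RtoC 1). intros H. eapply Rle_trans; [apply H|].
  unfold Rdiv at 2 3. rewrite <- Rmult_assoc.
  apply Rmult_le_compat_r; [apply Rlt_le, Rinv_0_lt_compat; lra|].
  assert (0 < r ^ n)%R by now apply pow_lt.
  assert (0 <= exp (Cmod (e2pi z) / (1 - r)) * Cmod (e2pi z))%R.
  { apply Rmult_le_pos; [apply Rlt_le, exp_pos|apply Cmod_ge_0]. }
  nra.
Qed.

Lemma Cmod_e2pi_tau_mono (z : C) (t : R) :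
  (0 <= t)%R -> (Cmod (e2pi (z + t * tau)) <= Cmod (e2pi z))%R.
Proof.
intros Ht. rewrite !Cmod_e2pi. apply exp_le.
replace (Im (z + t * tau)) with (Im z + t * Im tau)%R by (destruct z, tau; simpl; ring).
assert (P := PI_RGT_0). assert (0 <= t * Im tau)%R by (apply Rmult_le_pos; lra). nra.
Qed.

Lemma poch_trunc_bound_right (N : nat) (z : C) (t : R) :
  (0 <= t)%R -> (Cmod (poch_trunc N (z + t * tau)) <= exp (Cmod (e2pi z) / (1 - r)))%R.
Proof.
intros Ht. eapply Rle_trans; [apply poch_trunc_bound|]. apply exp_le.
destruct r_bounds as [R0 R1].
apply Rmult_le_compat_r; [apply Rlt_le, Rinv_0_lt_compat; lra|].
now apply Cmod_e2pi_tau_mono.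
Qed.

(** A move to the left by k steps brings in factors 1 - z q^(-i) with 1 <= i <= k, each at most (1 +
    |z|) r^(-i); their product yields the exponent k(k+1)/2. The bound is free of N, as Tannery
    requires. *)
Lemma poch_trunc_bound_left (z : C) (k N : nat) :
  (Cmod (poch_trunc N (z - INR k * tau)) <=
     exp (Cmod (e2pi z) / (1 - r) + ln (1 + Cmod (e2pi z)) * INR k
          + 2 * PI * Im tau * (INR k * (INR k + 1) / 2)))%R.
Proof.
destruct r_bounds as [R0 R1].
assert (PZ := Cmod_ge_0 (e2pi z)).
assert (PL : (0 <= ln (1 + Cmod (e2pi z)))%R).
{ rewrite <- ln_1. apply ln_le; lra. }
assert (PP := PI_RGT_0).
assert (PT : (0 < 2 * PI * Im tau)%R) by (apply Rmult_lt_0_compat; lra).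
revert N. induction k as [|k IH]; intros N.
- simpl. replace (z - 0 * tau) with z by ring.
  eapply Rle_trans; [apply poch_trunc_bound|]. right; f_equal; field; lra.
- set (X := exp _).
  destruct N as [|N].
  + unfold poch_trunc; simpl Cprod. rewrite Cmod_1. unfold X. apply Rle_trans with (exp 0); [rewrite exp_0; lra|apply exp_le].
    assert (Q := pos_INR (S k)).
    assert (0 <= Cmod (e2pi z) / (1 - r))%R.
    { apply Rmult_le_pos; [easy|]. apply Rlt_le, Rinv_0_lt_compat; lra. }
    assert (0 <= ln (1 + Cmod (e2pi z)) * INR (S k))%R by now apply Rmult_le_pos.
    assert (0 <= 2 * PI * Im tau * (INR (S k) * (INR (S k) + 1) / 2))%R.
    { apply Rmult_le_pos; [lra|]. nra. }
    lra.
  + rewrite poch_trunc_head, Cmod_mult.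
    replace (z - INR (S k) * tau + tau) with (z - INR k * tau)
      by (rewrite S_INR, RtoC_plus; ring).
    unfold X.
    replace (Cmod (e2pi z) / (1 - r) + ln (1 + Cmod (e2pi z)) * INR (S k)
          + 2 * PI * Im tau * (INR (S k) * (INR (S k) + 1) / 2))%R with
     ((ln (1 + Cmod (e2pi z)) + 2 * PI * Im tau * INR (S k)) +
       (Cmod (e2pi z) / (1 - r) + ln (1 + Cmod (e2pi z)) * INR k
          + 2 * PI * Im tau * (INR k * (INR k + 1) / 2)))%R
      by (rewrite S_INR; field; lra).
    rewrite exp_plus. apply Rmult_le_compat; try apply Cmod_ge_0; [|apply IH].
    rewrite exp_plus, exp_ln by lra.
    unfold Cminus at 1. eapply Rle_trans; [apply Cmod_triangle|].
    rewrite Cmod_opp, Cmod_1, e2pi_minus, Cmod_div by apply e2pi_neq_0.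
    rewrite (Cmod_e2pi (INR (S k) * tau)).
    replace (Im (INR (S k) * tau)) with (INR (S k) * Im tau)%R by (destruct tau; simpl; ring).
    unfold Rdiv. rewrite <- exp_Ropp.
    replace (- - (2 * PI * (INR (S k) * Im tau)))%R with (2 * PI * Im tau * INR (S k))%R by ring.
    assert (1 <= exp (2 * PI * Im tau * INR (S k)))%R.
    { apply Rle_trans with (exp 0); [rewrite exp_0; lra|apply exp_le].
      apply Rmult_le_pos; [lra|apply pos_INR]. }
    nra.
Qed.

(** For each m only one of the two factors is moved to the left, so the quadratic part of the growth
    is r^(-m^2/2) and not r^(-m^2). *)
Lemma poch_trunc_pair_bound (z w : C) :
  exists c b : R, forall (N M : nat) (m : Z),
    (Cmod (poch_trunc N (z + IZR m * tau) * poch_trunc M (w - IZR m * tau)) <=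
       exp (c + b * IZR (Z.abs m) + PI * Im tau * (IZR m * IZR m)))%R.
Proof.
destruct r_bounds as [R0 R1].
assert (PP := PI_RGT_0).
assert (PL : forall z, (0 <= ln (1 + Cmod (e2pi z)))%R).
{ intros x. rewrite <- ln_1. apply ln_le; [lra|]. generalize (Cmod_ge_0 (e2pi x)). lra. }
exists (Cmod (e2pi z) / (1 - r) + Cmod (e2pi w) / (1 - r))%R.
exists (ln (1 + Cmod (e2pi z)) + ln (1 + Cmod (e2pi w)) + PI * Im tau)%R.
intros N M m. rewrite Cmod_mult.
assert (PLz := PL z). assert (PLw := PL w).
destruct (Z.le_ge_cases 0 m) as [Hm|Hm].
- assert (E : IZR m = INR (Z.to_nat m)) by (rewrite INR_IZR_INZ, Z2Nat.id; easy).
  rewrite Z.abs_eq by easy. rewrite E. set (k := Z.to_nat m). assert (Q := pos_INR k).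
  eapply Rle_trans.
  { apply Rmult_le_compat; try apply Cmod_ge_0;
      [now apply poch_trunc_bound_right|apply poch_trunc_bound_left]. }
  rewrite <- exp_plus. apply exp_le.
  assert (0 <= ln (1 + Cmod (e2pi z)) * INR k)%R by now apply Rmult_le_pos. lra.
- assert (E : IZR m = (- INR (Z.to_nat (- m)))%R)
    by (rewrite INR_IZR_INZ, Z2Nat.id, opp_IZR by lia; ring).
  rewrite Z.abs_neq, opp_IZR by easy. rewrite E. set (k := Z.to_nat (- m)).
  assert (Q := pos_INR k).
  replace (z + (- INR k)%R * tau) with (z - INR k * tau) by (rewrite RtoC_opp; ring).
  replace (w - (- INR k)%R * tau) with (w + INR k * tau) by (rewrite RtoC_opp; ring).
  eapply Rle_trans.
  { apply Rmult_le_compat; try apply Cmod_ge_0;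
      [apply poch_trunc_bound_left|now apply poch_trunc_bound_right]. }
  rewrite <- exp_plus. apply exp_le.
  assert (0 <= ln (1 + Cmod (e2pi w)) * INR k)%R by now apply Rmult_le_pos. lra.
Qed.

Lemma poch_add_pair_bound (z w : C) :
  exists c b : R, forall (m : Z),
    (Cmod (poch_add (z + IZR m * tau) * poch_add (w - IZR m * tau)) <=
       exp (c + b * IZR (Z.abs m) + PI * Im tau * (IZR m * IZR m)))%R.
Proof.
destruct (poch_trunc_pair_bound z w) as [c [b H]]. exists c, b. intros m.
apply Clim_le with (fun N => poch_trunc N (z + IZR m * tau) * poch_trunc N (w - IZR m * tau)).
- apply Clim_mult; apply poch_add_lim.
- exists 0%nat. intros; apply H.
Qed.

(** The Weierstrass product inequality: a product of factors 1 - a_j is at least 1 minus the sum of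
    the a_j, here with that sum at most 1/2. *)
Lemma poch_trunc_lower (N : nat) (z : C) :
  (Cmod (e2pi z) / (1 - r) <= 1 / 2 ->
   1 - Cmod (e2pi z) * ((1 - r ^ N) / (1 - r)) <= Cmod (poch_trunc N z))%R.
Proof.
intros Hz. destruct r_bounds as [R0 R1].
assert (PZ := Cmod_ge_0 (e2pi z)).
assert (PI1 : (0 < / (1 - r))%R) by (apply Rinv_0_lt_compat; lra).
induction N as [|N IH].
- unfold poch_trunc; simpl. rewrite Cmod_1. right; field; lra.
- rewrite poch_trunc_S, Cmod_mult.
  assert (F : (1 - Cmod (e2pi z) * r ^ N <= Cmod (1 - e2pi (z + INR N * tau)))%R).
  { rewrite <- Cmod_factor.
    generalize (Cmod_triangle (1 - e2pi (z + INR N * tau)) (e2pi (z + INR N * tau))).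
    replace (1 - e2pi (z + INR N * tau) + e2pi (z + INR N * tau)) with (RtoC 1) by ring.
    rewrite Cmod_1. lra. }
  assert (PN : (0 < r ^ N <= 1)%R).
  { split; [now apply pow_lt|]. rewrite <- (pow1 N). apply pow_incr; lra. }
  set (S0 := (Cmod (e2pi z) * ((1 - r ^ N) / (1 - r)))%R) in *.
  replace (Cmod (e2pi z) * ((1 - r ^ S N) / (1 - r)))%R with (S0 + Cmod (e2pi z) * r ^ N)%R
    by (unfold S0; simpl; field; lra).
  assert (A : (0 <= S0)%R).
  { unfold S0. apply Rmult_le_pos; [easy|]. apply Rmult_le_pos; lra. }
  assert (B : (0 <= Cmod (e2pi z) * r ^ N)%R) by (apply Rmult_le_pos; lra).
  assert (B' : (Cmod (e2pi z) * r ^ N <= 1)%R).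
  { assert (Cmod (e2pi z) <= 1 / 2)%R.
    { apply Rle_trans with (Cmod (e2pi z) / (1 - r))%R; [|easy].
      assert (1 <= / (1 - r))%R by (rewrite <- Rinv_1; apply Rinv_le_contravar; lra).
      unfold Rdiv; nra. }
    nra. }
  assert (A' : (S0 <= 1)%R).
  { apply Rle_trans with (Cmod (e2pi z) / (1 - r))%R; [|lra].
    unfold S0, Rdiv. apply Rmult_le_compat_l; [easy|]. nra. }
  apply Rle_trans with ((1 - S0) * (1 - Cmod (e2pi z) * r ^ N))%R; [nra|].
  apply Rmult_le_compat; lra.
Qed.

(** Far enough to the right the partial products keep modulus at least 1/2; the functional equation
    then carries the nonvanishing back, one factor at a time. *)
Lemma poch_add_neq_0 (z : C) : (forall j : nat, e2pi (z + INR j * tau) <> 1) -> poch_add z <> 0.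
Proof.
intros H. destruct r_bounds as [R0 R1].
assert (PZ := Cmod_ge_0 (e2pi z)).
assert (HJ : exists J, (Cmod (e2pi (z + INR J * tau)) / (1 - r) <= 1 / 2)%R).
{ assert (Q : (0 < (1 - r) / 2 / (Cmod (e2pi z) + 1))%R).
  { apply Rdiv_lt_0_compat; lra. }
  destruct (pow_lt_1_zero r ltac:(rewrite Rabs_pos_eq; lra) _ Q) as [J HJ].
  exists J. specialize (HJ J (Nat.le_refl J)). rewrite Cmod_factor.
  assert (P : (0 < r ^ J)%R) by now apply pow_lt.
  rewrite Rabs_pos_eq in HJ by lra.
  apply Rmult_le_reg_r with (1 - r)%R; [lra|].
  replace (Cmod (e2pi z) * r ^ J / (1 - r) * (1 - r))%R with (Cmod (e2pi z) * r ^ J)%R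
    by (field; lra).
  apply Rle_trans with ((Cmod (e2pi z) + 1) * ((1 - r) / 2 / (Cmod (e2pi z) + 1)))%R.
  - apply Rmult_le_compat; lra.
  - right; field; lra. }
destruct HJ as [J HJ].
assert (T : poch_add (z + INR J * tau) <> 0).
{ intros E. destruct (poch_add_lim (z + INR J * tau) (1 / 2)%R ltac:(lra)) as [N HN].
  specialize (HN N (Nat.le_refl N)). rewrite E in HN.
  replace (poch_trunc N (z + INR J * tau) - 0) with (poch_trunc N (z + INR J * tau)) in HN by ring.
  assert (L := poch_trunc_lower N _ HJ).
  assert (0 < r ^ N)%R by now apply pow_lt.
  assert (0 < / (1 - r))%R by (apply Rinv_0_lt_compat; lra).
  assert (M : (Cmod (e2pi (z + INR J * tau)) * ((1 - r ^ N) / (1 - r))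
           <= Cmod (e2pi (z + INR J * tau)) / (1 - r))%R).
  { unfold Rdiv. apply Rmult_le_compat_l; [apply Cmod_ge_0|]. nra. }
  lra. }
clear HJ. induction J as [|J IH].
- simpl in T. now replace (z + 0 * tau) with z in T by ring.
- apply IH. rewrite poch_add_step.
  replace (z + INR J * tau + tau) with (z + INR (S J) * tau)
    by (rewrite S_INR, RtoC_plus; ring).
  apply Cmult_neq_0; [|easy].
  intros E. apply (H J). 
  replace (e2pi (z + INR J * tau)) with (1 - (1 - e2pi (z + INR J * tau))) by ring.
  rewrite E. ring.
Qed.

Lemma poch_add_shift_lim (z : C) : Clim (fun N => poch_add (z + INR N * tau)) 1.
Proof.
destruct r_bounds as [R0 R1]. intros eps He.
assert (PZ := Cmod_ge_0 (e2pi z)).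
set (K := (exp (Cmod (e2pi z) / (1 - r)) * Cmod (e2pi z) / (1 - r))%R).
assert (HK : (0 <= K)%R).
{ unfold K. apply Rmult_le_pos; [apply Rmult_le_pos; [apply Rlt_le, exp_pos|easy]|].
  apply Rlt_le, Rinv_0_lt_compat; lra. }
destruct (pow_lt_1_zero r ltac:(rewrite Rabs_pos_eq; lra) (eps / (K + 1)))
  as [N HN]; [apply Rdiv_lt_0_compat; lra|].
exists N. intros n Hn. specialize (HN n Hn).
assert (P : (0 < r ^ n)%R) by now apply pow_lt.
rewrite Rabs_pos_eq in HN by lra.
apply Rle_lt_trans with (K * r ^ n)%R.
{ eapply Rle_trans; [apply poch_add_near_1|].
  rewrite Cmod_factor. unfold K.
  replace (exp (Cmod (e2pi z) / (1 - r)) * Cmod (e2pi z) / (1 - r) * r ^ n)%R with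
    (exp (Cmod (e2pi z) / (1 - r)) * (Cmod (e2pi z) * r ^ n) / (1 - r))%R by (field; lra).
  apply Rmult_le_compat_r; [apply Rlt_le, Rinv_0_lt_compat; lra|].
  apply Rmult_le_compat_r; [apply Rmult_le_pos; lra|].
  apply exp_le. apply Rmult_le_compat_r; [apply Rlt_le, Rinv_0_lt_compat; lra|].
  assert (r ^ n <= 1)%R by (rewrite <- (pow1 n); apply pow_incr; lra). nra. }
apply Rle_lt_trans with (K * (eps / (K + 1)))%R.
{ apply Rmult_le_compat_l; lra. }
apply Rlt_le_trans with ((K + 1) * (eps / (K + 1)))%R.
{ apply Rmult_lt_compat_r; [apply Rdiv_lt_0_compat; lra|lra]. }
right; field; lra.
Qed.

(* (q^(n+1))_oo; its vanishing for negative n truncates bilateral sums to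
   unilateral or finite ones. *)
Definition euler_tail (n : Z) : C := poch_add (IZR (n + 1) * tau).

Lemma euler_tail_pred (n : Z) : euler_tail (n - 1) = (1 - e2pi (IZR n * tau)) * euler_tail n.
Proof.
unfold euler_tail. replace (n - 1 + 1)%Z with n by ring. rewrite poch_add_step.
f_equal. f_equal. rewrite plus_IZR, RtoC_plus. ring.
Qed.

(** (q^0)_oo contains the factor 1 - 1, and the recurrence hands the zero on to all smaller
    indices. *)
Lemma euler_tail_neg (n : Z) : (n < 0)%Z -> euler_tail n = 0.
Proof.
intros Hn. replace n with (- Z.of_nat (S (Z.to_nat (- n - 1))))%Z by lia.
generalize (Z.to_nat (- n - 1)). clear n Hn. intros k; induction k as [|k IH].
- replace (- Z.of_nat 1)%Z with (0 - 1)%Z by lia.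
  rewrite euler_tail_pred. simpl. replace (0 * tau) with (RtoC 0) by ring. rewrite e2pi_0. ring.
- replace (- Z.of_nat (S (S k)))%Z with (- Z.of_nat (S k) - 1)%Z by lia.
  rewrite euler_tail_pred, IH. ring.
Qed.

Lemma euler_tail_0_neq_0 : euler_tail 0 <> 0.
Proof.
apply poch_add_neq_0. intros j H.
assert (A : Cmod (e2pi (IZR (0 + 1) * tau + INR j * tau)) = 1) by now rewrite H, Cmod_1.
rewrite Cmod_factor in A. simpl in A.
replace (1 * tau) with tau in A by ring.
rewrite (Cmod_e2pi tau) in A. fold r in A. destruct r_bounds as [R0 R1].
assert (0 < r ^ j <= 1)%R.
{ split; [now apply pow_lt|]. rewrite <- (pow1 j). apply pow_incr; lra. }
nra.
Qed.

Lemma euler_tail_bound : exists K, (0 <= K)%R /\ forall n, (Cmod (euler_tail n) <= exp K)%R.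
Proof.
destruct r_bounds as [R0 R1].
exists (Cmod (e2pi 0) / (1 - r))%R. split.
{ apply Rmult_le_pos; [apply Cmod_ge_0|]. apply Rlt_le, Rinv_0_lt_compat; lra. }
intros n. destruct (Z.lt_ge_cases n 0) as [Hn|Hn].
- rewrite euler_tail_neg by easy. rewrite Cmod_0. apply Rlt_le, exp_pos.
- unfold euler_tail. eapply Rle_trans; [apply poch_add_bound|]. apply exp_le.
  apply Rmult_le_compat_r; [apply Rlt_le, Rinv_0_lt_compat; lra|].
  replace (IZR (n + 1) * tau) with (0 + IZR (n + 1) * tau) by ring.
  apply Cmod_e2pi_tau_mono. apply IZR_le. lia.
Qed.

Lemma euler_tail_lim (s k : Z) : (0 < s)%Z -> Clim (fun N => euler_tail (s * Z.of_nat N + k)) 1.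
Proof.
intros Hs eps He.
destruct (poch_add_shift_lim 0 eps He) as [N HN].
exists (N + Z.to_nat (Z.abs k))%nat. intros n Hn.
specialize (HN (Z.to_nat (s * Z.of_nat n + k + 1)) ltac:(nia)).
unfold euler_tail.
replace (IZR (s * Z.of_nat n + k + 1) * tau) with
  (0 + INR (Z.to_nat (s * Z.of_nat n + k + 1)) * tau); [easy|].
rewrite INR_IZR_INZ, Z2Nat.id by nia. ring.
Qed.

End Poch.

(** * The Jacobi triple product *)

Ltac push_IZR := repeat rewrite ?plus_IZR, ?minus_IZR, ?mult_IZR, ?opp_IZR,
  ?RtoC_plus, ?RtoC_minus, ?RtoC_mult, ?RtoC_opp.

Section Theta.
Variable tau : C.
Hypothesis Htau : (0 < Im tau)%R.
Notation E := (euler_tail tau).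
Notation Ph := (poch_add tau).
Notation PhN := (poch_trunc tau).

Lemma two_PI_tau_pos : (0 < 2 * PI * Im tau)%R.
Proof. assert (P := PI_RGT_0). apply Rmult_lt_0_compat; lra. Qed.

Definition theta_add (z : C) : C := Ph z * Ph (tau - z).

Lemma theta_Th (z : C) : theta tau (e2pi z) = theta_add z.
Proof. unfold theta, theta_add, poch_add, nome. now rewrite <- e2pi_minus. Qed.

Lemma theta_add_plus_tau (z : C) : theta_add (z + tau) = - e2pi (- z) * theta_add z.
Proof.
unfold theta_add. replace (tau - (z + tau)) with (- z) by ring.
rewrite (poch_add_step tau Htau z), (poch_add_step tau Htau (- z)).
replace (- z + tau) with (tau - z) by ring.
rewrite e2pi_opp. field. apply e2pi_neq_0.
Qed.

Lemma theta_add_reflect (z : C) : theta_add (tau - z) = theta_add z.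
Proof. unfold theta_add. replace (tau - (tau - z)) with z by ring. ring. Qed.

Lemma theta_add_opp (z : C) : theta_add (- z) = - e2pi (- z) * theta_add z.
Proof.
rewrite <- theta_add_plus_tau, <- theta_add_reflect. f_equal. ring.
Qed.

Lemma theta_add_neq_0 (z : C) : (forall n : Z, e2pi (z + IZR n * tau) <> 1) -> theta_add z <> 0.
Proof.
intros H. unfold theta_add. apply Cmult_neq_0; apply poch_add_neq_0; auto; intros j Hj.
- apply (H (Z.of_nat j)). now rewrite <- INR_IZR_INZ.
- apply (H (- (1 + Z.of_nat j))%Z). push_IZR. rewrite <- INR_IZR_INZ.
  replace (z + - (1 + INR j) * tau) with (- (tau - z + INR j * tau)) by ring.
  rewrite e2pi_opp, Hj. field.
Qed.

(** The sign (-1)^n is written as e2pi(n/2), so that the term is a single exponential of a quadratic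
    in n. *)
Definition theta_term (z : C) (n : Z) : C :=
  e2pi (IZR n / 2 + tau * (IZR n * (IZR n - 1) / 2) + IZR n * z).

Lemma theta_term_domK (z : C) (B : R) : exists K, forall g : Z -> C,
  (forall n, (Cmod (g n) <= exp B)%R) -> domK K (fun n => theta_term z n * g n).
Proof.
assert (P := two_PI_tau_pos).
destruct (domK_quad 0 (1 / 2 - tau / 2 + z) (tau / 2) B 0 0) as [K HK].
{ replace (Im (tau / 2)) with (Im tau / 2)%R; [lra|].
  replace (tau / 2) with ((/ 2)%R * tau) by (rewrite RtoC_inv by lra; field).
  destruct tau; simpl; lra. }
exists K. intros g Hg. apply HK with g.
- intros n. eapply Rle_trans; [apply Hg|]. apply exp_le. lra.
- intros n. unfold theta_term. f_equal. f_equal. field.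
Qed.

Lemma theta_term_succ (z : C) (k : Z) :
  theta_term z (k + 1) = - e2pi (IZR k * tau + z) * theta_term z k.
Proof.
unfold theta_term. rewrite <- e2pi_half_shift, <- e2pi_plus. f_equal. push_IZR. field.
Qed.

(** The two tails multiply to (q)_oo^2 / ((q)_(N+k) (q)_(N-k)), a q-binomial coefficient up to a
    factor free of k, and they vanish for |k| > N. Summing over all integers makes shifts of k free
    of boundary terms. *)
Definition gauss_sum (z : C) (N : nat) : C :=
  sumZ (fun k => theta_term z k * (E (Z.of_nat N + k) * E (Z.of_nat N - k))).

Lemma gauss_sum_domK (z : C) : exists K, forall N : nat,
  domK K (fun k => theta_term z k * (E (Z.of_nat N + k) * E (Z.of_nat N - k))).
Proof.
destruct (euler_tail_bound tau Htau) as [B [HB0 HB]].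
destruct (theta_term_domK z (B + B)) as [K HK].
exists K. intros N. apply HK. intros n. rewrite Cmod_mult, exp_plus.
apply Rmult_le_compat; auto; apply Cmod_ge_0.
Qed.

(** In multiplicative notation the two new factors expand to 1 + q^(2N+1) - z q^N - q^(N+1)/z, and
    multiplication by z or 1/z amounts to a shift of k. What remains is a recurrence of q-binomial
    coefficients, checked term by term. *)
Lemma gauss_sum_S (z : C) (N : nat) :
  (1 - e2pi (IZR (2 * Z.of_nat N + 1) * tau)) * (1 - e2pi (IZR (2 * Z.of_nat N + 2) * tau))
    * gauss_sum z (S N)
  = (1 - e2pi (z + INR N * tau)) * (1 - e2pi (tau - z + INR N * tau)) * gauss_sum z N.
Proof.
destruct (gauss_sum_domK z) as [K HK].
set (f := fun k => theta_term z k * (E (Z.of_nat N + k) * E (Z.of_nat N - k))).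
assert (Df : dom f) by (exists K; apply HK).
unfold gauss_sum at 2. fold f.
set (P := e2pi (IZR (Z.of_nat N) * tau)).
set (Q := e2pi tau).
set (x := e2pi z).
assert (Nx : x <> 0) by apply e2pi_neq_0.
assert (NQ : Q <> 0) by apply e2pi_neq_0.
assert (NP : P <> 0) by apply e2pi_neq_0.
rewrite INR_IZR_INZ.
replace (e2pi (z + IZR (Z.of_nat N) * tau)) with (x * P) by now rewrite e2pi_plus.
replace (e2pi (tau - z + IZR (Z.of_nat N) * tau)) with (Q / x * P)
  by now rewrite e2pi_plus, e2pi_minus.
replace (e2pi (IZR (2 * Z.of_nat N + 1) * tau)) with (P * P * Q).
2:{ unfold P, Q. rewrite <- !e2pi_plus. f_equal. push_IZR. ring. }
replace (e2pi (IZR (2 * Z.of_nat N + 2) * tau)) with (P * P * Q * Q).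
2:{ unfold P, Q. rewrite <- !e2pi_plus. f_equal. push_IZR. ring. }
transitivity ((1 + P * P * Q) * sumZ f - x * P * sumZ (fun k => f (k + -1)%Z)
                - Q / x * P * sumZ (fun k => f (k + 1)%Z)).
2:{ rewrite !sumZ_shift by easy. field. easy. }
assert (D1 := dom_shift f 1 Df). assert (D2 := dom_shift f (-1) Df).
replace ((1 + P * P * Q) * sumZ f - x * P * sumZ (fun k => f (k + -1)%Z)
                - Q / x * P * sumZ (fun k => f (k + 1)%Z)) with
  ((1 + P * P * Q) * sumZ f + (- (x * P) * sumZ (fun k => f (k + -1)%Z)
                + - (Q / x * P) * sumZ (fun k => f (k + 1)%Z))) by ring.
rewrite <- !sumZ_scal, <- !sumZ_plus; repeat (apply dom_plus || apply dom_scal); auto.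
unfold gauss_sum. rewrite <- sumZ_scal by (exists K; apply HK).
apply sumZ_ext; [apply dom_scal; exists K; apply HK|].
intros k. unfold f.
replace (theta_term z (k + 1)) with (- (e2pi (IZR k * tau) * x) * theta_term z k)
  by now rewrite theta_term_succ, e2pi_plus.
set (y := e2pi (IZR k * tau)).
assert (Ny : y <> 0) by apply e2pi_neq_0.
assert (W : theta_term z k = - (y / Q * x) * theta_term z (k + -1)).
{ replace k with ((k + -1) + 1)%Z at 1 by ring. rewrite theta_term_succ.
  f_equal. f_equal. unfold y, Q, x. rewrite <- e2pi_minus, <- e2pi_plus. f_equal.
  push_IZR. ring. }
replace (theta_term z (k + -1)) with (- (Q / (y * x)) * theta_term z k)
  by (rewrite W; field; auto).
replace (Z.of_nat (S N)) with (Z.of_nat N + 1)%Z by lia.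
(* All tails are expressed through the two of largest index, which leaves a rational identity in P,
   Q, x and y. *)
set (A := E (Z.of_nat N + 1 + k)). set (B := E (Z.of_nat N + 1 - k)).
assert (EA : forall m, E (m - 1) = (1 - e2pi (IZR m * tau)) * E m)
  by (intros m; now apply euler_tail_pred).
replace (Z.of_nat N + k)%Z with (Z.of_nat N + 1 + k - 1)%Z by ring.
replace (Z.of_nat N - k)%Z with (Z.of_nat N + 1 - k - 1)%Z by ring.
replace (Z.of_nat N + (k + -1))%Z with (Z.of_nat N + 1 + k - 1 - 1)%Z by ring.
replace (Z.of_nat N - (k + -1))%Z with (Z.of_nat N + 1 - k)%Z by ring.
replace (Z.of_nat N + (k + 1))%Z with (Z.of_nat N + 1 + k)%Z by ring.
replace (Z.of_nat N - (k + 1))%Z with (Z.of_nat N + 1 - k - 1 - 1)%Z by ring.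
rewrite !EA. fold A B.
replace (e2pi (IZR (Z.of_nat N + 1 + k - 1) * tau)) with (P * y).
2:{ unfold P, y. rewrite <- !e2pi_plus. f_equal. push_IZR. ring. }
replace (e2pi (IZR (Z.of_nat N + 1 + k) * tau)) with (P * y * Q).
2:{ unfold P, y, Q. rewrite <- !e2pi_plus. f_equal. push_IZR. ring. }
replace (e2pi (IZR (Z.of_nat N + 1 - k - 1) * tau)) with (P / y).
2:{ unfold P, y. rewrite <- e2pi_minus. f_equal. push_IZR. ring. }
replace (e2pi (IZR (Z.of_nat N + 1 - k) * tau)) with (P / y * Q).
2:{ unfold P, y, Q. rewrite <- e2pi_minus, <- e2pi_plus. f_equal. push_IZR. ring. }
field. auto.
Qed.

(** A form of the finite q-binomial theorem; its limit N to infinity is Jacobi's identity. *)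
Lemma finite_triple_product (z : C) (N : nat) :
  E 0 * E 0 * (PhN N z * PhN N (tau - z)) = PhN (2 * N) tau * gauss_sum z N.
Proof.
induction N as [|N IH].
- unfold gauss_sum. rewrite sumZ_finite0.
  + unfold theta_term, poch_trunc. simpl. rewrite <- e2pi_0 at 1.
    replace (0 / 2 + tau * (0 * (0 - 1) / 2) + 0 * z) with (RtoC 0) by field.
    rewrite e2pi_0. ring.
  + intros n Hn. simpl.
    destruct (Z.lt_ge_cases n 0) as [H|H].
    * rewrite (euler_tail_neg tau Htau n) by easy. ring.
    * rewrite (euler_tail_neg tau Htau (- n)) by lia. ring.
- replace (2 * S N)%nat with (S (S (2 * N))) by lia.
  rewrite (poch_trunc_S tau (S (2 * N))), (poch_trunc_S tau (2 * N)), (poch_trunc_S tau N), (poch_trunc_S tau N).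
  transitivity (E 0 * E 0 * (PhN N z * PhN N (tau - z)) *
     ((1 - e2pi (z + INR N * tau)) * (1 - e2pi (tau - z + INR N * tau)))); [ring|].
  rewrite IH.
  transitivity (PhN (2 * N) tau * ((1 - e2pi (z + INR N * tau))
     * (1 - e2pi (tau - z + INR N * tau)) * gauss_sum z N)); [ring|].
  rewrite <- gauss_sum_S.
  replace (tau + INR (2 * N) * tau) with (IZR (2 * Z.of_nat N + 1) * tau).
  2:{ rewrite INR_IZR_INZ, Nat2Z.inj_mul. simpl (Z.of_nat 2). push_IZR. ring. }
  replace (tau + INR (S (2 * N)) * tau) with (IZR (2 * Z.of_nat N + 2) * tau).
  2:{ rewrite S_INR, INR_IZR_INZ, Nat2Z.inj_mul. simpl (Z.of_nat 2). push_IZR. ring. }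
  ring.
Qed.

Lemma jacobi_triple_product (z : C) : E 0 * theta_add z = sumZ (theta_term z).
Proof.
assert (L1 : Clim (fun N => E 0 * E 0 * (PhN N z * PhN N (tau - z))) (E 0 * E 0 * theta_add z)).
{ apply Clim_scal, Clim_mult; now apply poch_add_lim. }
assert (L2 : Clim (fun N => PhN (2 * N) tau * gauss_sum z N) (E 0 * sumZ (theta_term z))).
{ apply Clim_mult.
  - replace (E 0) with (Ph tau) by (unfold euler_tail; f_equal; simpl; ring).
    apply (Clim_subseq (fun N => PhN N tau) _ (fun N => 2 * N)%nat); [lia|now apply poch_add_lim].
  - destruct (gauss_sum_domK z) as [K HK].
    apply (tannery K); [exact HK|]. intros k.
    apply Clim_eq with (theta_term z k * (1 * 1)); [|ring].
    apply Clim_scal. apply Clim_mult.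
    + apply Clim_ext with (fun N => E (1 * Z.of_nat N + k)); [intros n; f_equal; lia|].
      now apply euler_tail_lim.
    + apply Clim_ext with (fun N => E (1 * Z.of_nat N + - k)); [intros n; f_equal; lia|].
      now apply euler_tail_lim. }
assert (H : E 0 * E 0 * theta_add z = E 0 * sumZ (theta_term z)).
{ apply Clim_unique with (1 := L1). apply Clim_ext with (2 := L2).
  intros N; now rewrite finite_triple_product. }
assert (N0 := euler_tail_0_neq_0 tau Htau).
replace (sumZ (theta_term z)) with (/ E 0 * (E 0 * sumZ (theta_term z))) by (field; easy).
rewrite <- H. field. easy.
Qed.

Lemma theta_term_dom (z : C) : dom (theta_term z).
Proof.
destruct (theta_term_domK z 0) as [K HK].
apply dom_ext with (fun n => theta_term z n * 1); [intros; ring|].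
exists K. apply HK. intros n. rewrite Cmod_1, exp_0. lra.
Qed.

Lemma vartheta11_Th (v : C) :
  vartheta11 tau v = - Ci * e2pi (tau / 8) * e2pi (- v / 2) * (E 0 * theta_add v).
Proof.
unfold vartheta11.
assert (D := theta_term_dom (v + tau)).
(* The constant v/2 + 1/4 + tau/8 is the exponent at n = 0 in units of 2 pi i; the remaining
   exponent is that of a theta series at v + tau. *)
transitivity (sumZ (fun n => e2pi (v / 2 + 1 / 4 + tau / 8) * theta_term (v + tau) n)).
- symmetry. apply sumZ_ext; [now apply dom_scal|].
  intros n. unfold theta_term. rewrite <- e2pi_plus. unfold e2pi. f_equal. field.
- rewrite sumZ_scal by easy. rewrite <- jacobi_triple_product, theta_add_plus_tau.
  rewrite !e2pi_plus, e2pi_quarter.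
  replace (- v / 2) with (- v - - (v / 2)) by field.
  rewrite e2pi_minus, e2pi_opp, (e2pi_opp (v / 2)). field. split; apply e2pi_neq_0.
Qed.

End Theta.

(** * Theta functions of degree two *)

Section Poincare.
Variables tau gam : C.
Hypothesis Htau : (0 < Im tau)%R.
Notation E := (euler_tail tau).
Notation Ph := (poch_add tau).
Notation PhN := (poch_trunc tau).
Notation Th := (theta_add tau).

(** The cocycle of the quasi-periodicity, with C = e2pi gam: [weight (w + tau) m] is
    [weight w (m + 1)] divided by C e2pi(w)^2. *)
Definition weight (w : C) (m : Z) : C :=
  e2pi (IZR m * gam + 2 * IZR m * w + tau * (IZR m * (IZR m - 1))).

Definition poincare (P : C -> C) (w : C) : C :=
  sumZ (fun m => weight w m * P (w + IZR m * tau)).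

(** The power j serves the induction: peeling off the last factor of the first product adds a term
    with j + 1, of the second a term with j - 1. Separate lengths N and M allow one product to be
    peeled at a time. *)
Definition poch_pair_trunc (xi kap : C) (N M : nat) (j : Z) (w : C) : C :=
  e2pi (IZR j * w) * (PhN N (xi + w) * PhN M (kap - w)).

Definition poch_pair (xi kap w : C) : C := Ph (xi + w) * Ph (kap - w).

Definition mono (j : Z) (w : C) : C := poincare (fun w => e2pi (IZR j * w)) w.

Lemma poch_pair_trunc_domK (xi kap w : C) (j : Z) : exists K, forall N M,
  domK K (fun m => weight w m * poch_pair_trunc xi kap N M j (w + IZR m * tau)).
Proof.
assert (P := two_PI_tau_pos tau Htau).
destruct (poch_trunc_pair_bound tau Htau (xi + w) (kap - w)) as [c [b Hb]].
destruct (domK_quad (IZR j * w) (gam + 2 * w - tau + IZR j * tau) tau c b (PI * Im tau))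
  as [K HK]; [lra|].
exists K. intros N M.
apply HK with (fun m => PhN N (xi + w + IZR m * tau) * PhN M (kap - w - IZR m * tau)).
- intros m; apply Hb.
- intros m. unfold weight, poch_pair_trunc. rewrite Cmult_assoc, <- e2pi_plus. f_equal.
  + f_equal. ring.
  + f_equal; f_equal; ring.
Qed.

Lemma poch_pair_trunc_dom (xi kap w : C) (N M : nat) (j : Z) :
  dom (fun m => weight w m * poch_pair_trunc xi kap N M j (w + IZR m * tau)).
Proof. destruct (poch_pair_trunc_domK xi kap w j) as [K HK]. exists K; apply HK. Qed.

Lemma mono_dom (j : Z) (w : C) :
  dom (fun m => weight w m * e2pi (IZR j * (w + IZR m * tau))).
Proof.
apply dom_ext with (2 := poch_pair_trunc_dom 0 0 w 0 0 j).
intros m. unfold poch_pair_trunc, poch_trunc; simpl. ring.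
Qed.

(** This is the substitution of m + 1 for m. Two consecutive values of j therefore determine all
    others, so the monomial series span at most a plane. *)
Lemma mono_step (j : Z) (w : C) :
  mono (j + 2) w = e2pi (- gam - IZR j * tau) * mono j w.
Proof.
unfold mono, poincare.
rewrite <- (sumZ_succ _ (mono_dom j w)).
rewrite <- sumZ_scal by apply (dom_shift _ 1 (mono_dom j w)).
apply sumZ_ext; [apply mono_dom|].
intros m. unfold weight. rewrite <- !e2pi_plus. f_equal. push_IZR. ring.
Qed.

(** A determinant of values at two points; no derivative is involved. *)
Definition wronskian (a b : C) : C := mono 0 a * mono 1 b - mono 1 a * mono 0 b.

(* Membership in the span of [mono 0] and [mono 1], stated as the vanishing of
   a 3 by 3 determinant. *)
Definition mono_span (H : C -> C) : Prop := forall a b c,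
  H a * wronskian b c + H b * wronskian c a + H c * wronskian a b = 0.

Lemma mono_span_scal (k : C) (H : C -> C) : mono_span H -> mono_span (fun w => k * H w).
Proof.
intros G a b c.
transitivity (k * (H a * wronskian b c + H b * wronskian c a + H c * wronskian a b)); [ring|].
rewrite G. ring.
Qed.

Lemma mono_span_plus (H1 H2 : C -> C) : mono_span H1 -> mono_span H2 -> mono_span (fun w => H1 w + H2 w).
Proof.
intros G1 G2 a b c.
transitivity ((H1 a * wronskian b c + H1 b * wronskian c a + H1 c * wronskian a b)
  + (H2 a * wronskian b c + H2 b * wronskian c a + H2 c * wronskian a b)); [ring|].
rewrite G1, G2. ring.
Qed.

Lemma mono_span_ext (H1 H2 : C -> C) : (forall w, H1 w = H2 w) -> mono_span H1 -> mono_span H2.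
Proof. intros Heq G a b c. rewrite <- !Heq. apply G. Qed.

Lemma mono_span_mono (j : Z) : mono_span (mono j).
Proof.
(* The recurrence has step two, so the induction carries a pair of neighbours. *)
enough (mono_span (mono j) /\ mono_span (mono (j + 1))) by easy.
induction j as [|j [G0 G1]|j [G0 G1]] using Z.peano_ind.
- split; intros a b c; unfold wronskian; simpl; ring.
- replace (Z.succ j) with (j + 1)%Z by lia. split; [easy|].
  apply mono_span_ext with (2 := mono_span_scal (e2pi (- gam - IZR j * tau)) _ G0).
  intros w. rewrite <- mono_step. f_equal. ring.
- replace (Z.pred j) with (j - 1)%Z by lia. replace (j - 1 + 1)%Z with j by ring.
  split; [|easy].
  apply mono_span_ext with (2 := mono_span_scal (/ e2pi (- gam - IZR (j - 1) * tau)) _ G1).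
  intros w. replace (j + 1)%Z with (j - 1 + 2)%Z by ring. rewrite mono_step.
  field. apply e2pi_neq_0.
Qed.

Lemma mono_span_poch_pair_trunc (xi kap : C) (N M : nat) : forall j, mono_span (poincare (poch_pair_trunc xi kap N M j)).
Proof.
induction N as [|N IN]; [induction M as [|M IM]|]; intros j.
- apply mono_span_ext with (2 := mono_span_mono j). intros w. apply sumZ_ext; [apply mono_dom|].
  intros m. unfold poch_pair_trunc, poch_trunc; simpl. ring.
- apply mono_span_ext with
    (2 := mono_span_plus _ _ (IM j) (mono_span_scal (- e2pi (kap + INR M * tau)) _ (IM (j - 1)%Z))).
  intros w. unfold poincare.
  rewrite <- sumZ_scal, <- sumZ_plus by (try apply dom_scal; apply poch_pair_trunc_dom).
  symmetry. apply sumZ_ext; [apply poch_pair_trunc_dom|].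
  intros m. unfold poch_pair_trunc. rewrite poch_trunc_S.
  replace (kap - (w + IZR m * tau) + INR M * tau) with
    ((kap + INR M * tau) - (w + IZR m * tau)) by ring.
  replace (IZR (j - 1) * (w + IZR m * tau)) with
    (IZR j * (w + IZR m * tau) - (w + IZR m * tau)) by (push_IZR; ring).
  rewrite !e2pi_minus. field. apply e2pi_neq_0.
- apply mono_span_ext with
    (2 := mono_span_plus _ _ (IN j) (mono_span_scal (- e2pi (xi + INR N * tau)) _ (IN (j + 1)%Z))).
  intros w. unfold poincare.
  rewrite <- sumZ_scal, <- sumZ_plus by (try apply dom_scal; apply poch_pair_trunc_dom).
  symmetry. apply sumZ_ext; [apply poch_pair_trunc_dom|].
  intros m. unfold poch_pair_trunc. rewrite poch_trunc_S.
  replace (xi + (w + IZR m * tau) + INR N * tau) with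
    ((xi + INR N * tau) + (w + IZR m * tau)) by ring.
  replace (IZR (j + 1) * (w + IZR m * tau)) with
    (IZR j * (w + IZR m * tau) + (w + IZR m * tau)) by (push_IZR; ring).
  rewrite !e2pi_plus. ring.
Qed.

Lemma poincare_poch_pair_lim (xi kap w : C) :
  dom (fun m => weight w m * poch_pair xi kap (w + IZR m * tau)) /\
  Clim (fun N => poincare (poch_pair_trunc xi kap N N 0) w) (poincare (poch_pair xi kap) w).
Proof.
destruct (poch_pair_trunc_domK xi kap w 0) as [K HK].
destruct (tannery K (fun N m => weight w m * poch_pair_trunc xi kap N N 0 (w + IZR m * tau))
  (fun m => weight w m * poch_pair xi kap (w + IZR m * tau))) as [D L].
- intros N; apply HK.
- intros m. apply Clim_scal. unfold poch_pair.
  apply Clim_ext with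
    (fun N => PhN N (xi + (w + IZR m * tau)) * PhN N (kap - (w + IZR m * tau))).
  + intros N. unfold poch_pair_trunc. replace (IZR 0 * (w + IZR m * tau)) with (RtoC 0) by (simpl; ring).
    rewrite e2pi_0. ring.
  + apply Clim_mult; now apply poch_add_lim.
- split; [now exists K|exact L].
Qed.

(** The determinant relation passes to pointwise limits, so the coefficients of the truncated series
    in the two basis functions need not be followed. *)
Lemma mono_span_poch_pair (xi kap : C) : mono_span (poincare (poch_pair xi kap)).
Proof.
intros a b c.
assert (L := poincare_poch_pair_lim xi kap).
apply Clim_unique with (fun N : nat => 0); [|apply Clim_const].
apply Clim_ext with (fun N =>
   wronskian b c * poincare (poch_pair_trunc xi kap N N 0) a
   + wronskian c a * poincare (poch_pair_trunc xi kap N N 0) b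
   + wronskian a b * poincare (poch_pair_trunc xi kap N N 0) c).
- intros N. rewrite <- (mono_span_poch_pair_trunc xi kap N N 0 a b c). ring.
- eapply Clim_eq.
  + apply Clim_plus; [apply Clim_plus|]; apply Clim_scal; apply L.
  + ring.
Qed.

Lemma mono_even (i : Z) (w : C) :
  mono (2 * i) w = e2pi (- IZR i * gam - IZR i * (IZR i - 1) * tau) * mono 0 w.
Proof.
induction i as [|i IH|i IH] using Z.peano_ind.
- simpl. replace (- 0 * gam - 0 * (0 - 1) * tau) with (RtoC 0) by ring. rewrite e2pi_0. ring.
- replace (2 * Z.succ i)%Z with (2 * i + 2)%Z by lia. rewrite mono_step, IH.
  rewrite Cmult_assoc, <- e2pi_plus. f_equal. f_equal. unfold Z.succ. push_IZR. ring.
- assert (S := mono_step (2 * Z.pred i) w).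
  replace (2 * Z.pred i + 2)%Z with (2 * i)%Z in S by lia.
  assert (N := e2pi_neq_0 (- gam - IZR (2 * Z.pred i) * tau)).
  replace (mono (2 * Z.pred i) w) with
    (e2pi (- (- gam - IZR (2 * Z.pred i) * tau)) * mono (2 * i) w)
    by (rewrite S, e2pi_opp; field; easy).
  rewrite IH, Cmult_assoc, <- e2pi_plus. f_equal. f_equal.
  replace (Z.pred i) with (i - 1)%Z by lia. push_IZR. ring.
Qed.

Lemma mono_odd (i : Z) (w : C) :
  mono (2 * i + 1) w = e2pi (- IZR i * gam - IZR i * IZR i * tau) * mono 1 w.
Proof.
induction i as [|i IH|i IH] using Z.peano_ind.
- simpl. replace (- 0 * gam - 0 * 0 * tau) with (RtoC 0) by ring. rewrite e2pi_0. ring.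
- replace (2 * Z.succ i + 1)%Z with (2 * i + 1 + 2)%Z by lia. rewrite mono_step, IH.
  rewrite Cmult_assoc, <- e2pi_plus. f_equal. f_equal. unfold Z.succ. push_IZR. ring.
- assert (S := mono_step (2 * Z.pred i + 1) w).
  replace (2 * Z.pred i + 1 + 2)%Z with (2 * i + 1)%Z in S by lia.
  assert (N := e2pi_neq_0 (- gam - IZR (2 * Z.pred i + 1) * tau)).
  replace (mono (2 * Z.pred i + 1) w) with
    (e2pi (- (- gam - IZR (2 * Z.pred i + 1) * tau)) * mono (2 * i + 1) w)
    by (rewrite S, e2pi_opp; field; easy).
  rewrite IH, Cmult_assoc, <- e2pi_plus. f_equal. f_equal.
  replace (Z.pred i) with (i - 1)%Z by lia. push_IZR. ring.
Qed.

(** The form m^2 + jm + j^2/2 is positive definite, which gives decay in both indices at once, as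
    Fubini needs. *)
Lemma gauss_product_bound (A B : C) : exists K, forall m j : Z,
  (Cmod (e2pi (IZR m * A + IZR j * B
     + tau * (IZR m * IZR m + IZR j * IZR m + IZR j * IZR j / 2)))
   <= K * exp (- IZR (Z.abs m)) * exp (- IZR (Z.abs j)))%R.
Proof.
assert (P := two_PI_tau_pos tau Htau).
(* The smallest eigenvalue of the form is (3 - sqrt 5)/4, which exceeds 1/6, so (m^2 + j^2)/6 can be
   split off. *)
set (L := (2 * PI * Im tau / 6)%R).
assert (HL : (0 < L)%R) by (unfold L; lra).
assert (G : forall b, exists K, forall n : Z,
  (exp (b * IZR (Z.abs n) - L * (IZR n * IZR n)) <= K * exp (- IZR (Z.abs n)))%R).
{ intros b. eexists. intros n.
  assert (D := domK_gauss 0 b L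
    (fun n => RtoC (exp (b * IZR (Z.abs n) - L * (IZR n * IZR n)))) HL).
  specialize (D ltac:(intros k; cbv beta; rewrite Cmod_R, Rabs_pos_eq by (apply Rlt_le, exp_pos);
                      apply exp_le; lra) n).
  cbv beta in D. rewrite Cmod_R, Rabs_pos_eq in D by (apply Rlt_le, exp_pos). exact D. }
destruct (G (Rabs (2 * PI * Im A))) as [K1 H1].
destruct (G (Rabs (2 * PI * Im B))) as [K2 H2].
exists (K1 * K2)%R. intros m j.
specialize (H1 m). specialize (H2 j).
apply Rle_trans with
  (exp (Rabs (2 * PI * Im A) * IZR (Z.abs m) - L * (IZR m * IZR m)) *
   exp (Rabs (2 * PI * Im B) * IZR (Z.abs j) - L * (IZR j * IZR j)))%R.
2:{ replace (K1 * K2 * exp (- IZR (Z.abs m)) * exp (- IZR (Z.abs j)))%R with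
      ((K1 * exp (- IZR (Z.abs m))) * (K2 * exp (- IZR (Z.abs j))))%R by ring.
    apply Rmult_le_compat; try easy; apply Rlt_le, exp_pos. }
rewrite <- exp_plus, Cmod_e2pi. apply exp_le.
replace (Im _) with (IZR m * Im A + IZR j * Im B
   + Im tau * (IZR m * IZR m + IZR j * IZR m + IZR j * IZR j / 2))%R.
2:{ replace (IZR j * IZR j / 2) with (RtoC (IZR j * IZR j / 2)%R)
      by (rewrite RtoC_div by lra; now rewrite RtoC_mult).
    destruct A, B, tau; simpl; ring. }
assert (a := Rle_abs (- (2 * PI * Im A * IZR m))). rewrite Rabs_Ropp, Rabs_mult in a.
assert (b := Rle_abs (- (2 * PI * Im B * IZR j))). rewrite Rabs_Ropp, Rabs_mult in b.
rewrite !abs_IZR. unfold L.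
(* m^2 + jm + j^2/2 - (m^2 + j^2)/6 = (5m + 3j)^2/30 + j^2/30 *)
assert (Q : (0 <= 2 * PI * Im tau * ((5 * IZR m + 3 * IZR j) * (5 * IZR m + 3 * IZR j) / 30
                + IZR j * IZR j / 30))%R).
{ apply Rmult_le_pos; [lra|].
  generalize (Rle_0_sqr (5 * IZR m + 3 * IZR j)) (Rle_0_sqr (IZR j)). unfold Rsqr. lra. }
lra.
Qed.

(** Two triple product series are multiplied and their indices taken as m and j + m. Only the power
    -j of e2pi p survives, and the sum over m is [mono j w]. Even j reduce to [mono 0 w] and odd j
    to [mono 1 w]; the remaining sums are Poincare series at p, and the sign (-1)^j makes the result
    a determinant. *)
Lemma theta_product (w p : C) :
  E 0 * E 0 * (Th (w - p) * Th (gam + w + p)) = e2pi (- p) * wronskian w p.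
Proof.
set (t := theta_term tau).
assert (Dt : forall z, dom (t z)) by (intros z; apply theta_term_dom, Htau).
set (F := fun m j : Z => e2pi (IZR m * (gam + 2 * w - tau) + IZR j * (1 / 2 + w - p - tau / 2)
     + tau * (IZR m * IZR m + IZR j * IZR m + IZR j * IZR j / 2))).
destruct (gauss_product_bound (gam + 2 * w - tau) (1 / 2 + w - p - tau / 2)) as [K HK].
fold F in HK.
(* The signs (-1)^m and (-1)^(j+m) combine to (-1)^j; the leftover (-1)^(2m) is the factor
   [e2pi (IZR m)]. *)
assert (HF : forall m j, t (gam + w + p) m * t (w - p) (j + m)%Z = F m j).
{ intros m j. transitivity (F m j * e2pi (IZR m)); [|rewrite e2pi_IZR; ring].
  unfold t, theta_term, F. rewrite <- !e2pi_plus. f_equal. push_IZR. field. }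
assert (HG : forall m j, F m j = t (- p) j * (weight w m * e2pi (IZR j * (w + IZR m * tau)))).
{ intros m j. unfold t, theta_term, F, weight. rewrite <- !e2pi_plus. f_equal. field. }
transitivity ((E 0 * Th (gam + w + p)) * (E 0 * Th (w - p))); [ring|].
rewrite !jacobi_triple_product by easy. fold t.
transitivity (sumZ (fun m => sumZ (fun j => F m j))).
{ rewrite Cmult_comm, <- sumZ_scal by easy.
  apply sumZ_ext; [apply dom_scal; easy|]. intros m.
  rewrite Cmult_comm, <- (sumZ_shift (t (w - p)) m) by easy.
  rewrite <- sumZ_scal by now apply dom_shift.
  apply sumZ_ext; [apply dom_scal; now apply dom_shift|]. intros j. apply HF. }
rewrite (fubini_sumZ K F HK).
assert (DF := dom_sumZ K F HK).
assert (HM : forall j, sumZ (fun m => F m j) = t (- p) j * mono j w).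
{ intros j. unfold mono, poincare. rewrite <- sumZ_scal by apply mono_dom.
  symmetry. apply sumZ_ext; [apply dom_scal, mono_dom|]. intros m. now rewrite HG. }
rewrite sumZ_even_odd by easy.
assert (D0 := mono_dom 1 p). assert (D1 := mono_dom 0 p).
(* The series of [mono 1] at p appears here in reverse order, with -i as its index; in [S1] it is
   that of [mono 0]. *)
assert (S0 : sumZ (fun i => sumZ (fun m => F m (2 * i)%Z)) = e2pi (- p) * mono 1 p * mono 0 w).
{ transitivity (sumZ (fun i => mono 0 w * e2pi (- p) *
     (weight p (- i) * e2pi (IZR 1 * (p + IZR (- i) * tau))))).
  - symmetry. apply sumZ_ext; [apply dom_scal, (dom_opp _ D0)|].
    intros i. rewrite HM, mono_even. unfold t, theta_term, weight.
    transitivity (mono 0 w * (e2pi (- p) * (e2pi (IZR (- i) * gam + 2 * IZR (- i) * p +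
         tau * (IZR (- i) * (IZR (- i) - 1))) * e2pi (IZR 1 * (p + IZR (- i) * tau)))
         * e2pi (IZR i))); [rewrite e2pi_IZR; ring|].
    rewrite (Cmult_assoc _ _ (mono 0 w)), (Cmult_comm _ (mono 0 w)).
    f_equal. rewrite <- !e2pi_plus. f_equal. push_IZR. field.
  - rewrite sumZ_scal by apply (dom_opp _ D0).
    rewrite (sumZ_opp (fun i => weight p i * e2pi (IZR 1 * (p + IZR i * tau)))) by easy.
    unfold mono at 2, poincare. ring. }
assert (S1 : sumZ (fun i => sumZ (fun m => F m (2 * i + 1)%Z))
             = - (e2pi (- p) * mono 0 p * mono 1 w)).
{ transitivity (sumZ (fun i => - (mono 1 w) * e2pi (- p) *
     (weight p (- i) * e2pi (IZR 0 * (p + IZR (- i) * tau))))).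
  - symmetry. apply sumZ_ext; [apply dom_scal, (dom_opp _ D1)|].
    intros i. rewrite HM, mono_odd. unfold t, theta_term, weight.
    transitivity (mono 1 w * - (e2pi (- p) * (e2pi (IZR (- i) * gam + 2 * IZR (- i) * p +
         tau * (IZR (- i) * (IZR (- i) - 1))) * e2pi (IZR 0 * (p + IZR (- i) * tau))
         * e2pi (IZR i)))); [rewrite e2pi_IZR; ring|].
    rewrite (Cmult_assoc _ _ (mono 1 w)), (Cmult_comm _ (mono 1 w)).
    f_equal. rewrite <- !e2pi_plus, <- e2pi_half_shift. f_equal. push_IZR. field.
  - rewrite sumZ_scal by apply (dom_opp _ D1).
    rewrite (sumZ_opp (fun i => weight p i * e2pi (IZR 0 * (p + IZR i * tau)))) by easy.
    unfold mono at 2, poincare. ring. }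
rewrite S0, S1. unfold wronskian. ring.
Qed.

(** [theta_product] evaluates all three determinants, and the common factor (q)_oo^2 is nonzero. *)
Lemma three_term (H : C -> C) (a b c : C) : mono_span H ->
  H a * e2pi c * (Th (b - c) * Th (gam + b + c))
  + H b * e2pi a * (Th (c - a) * Th (gam + c + a))
  + H c * e2pi b * (Th (a - b) * Th (gam + a + b)) = 0.
Proof.
intros G. specialize (G a b c).
assert (N0 := euler_tail_0_neq_0 tau Htau).
assert (W : forall x y, wronskian x y
   = E 0 * E 0 * (e2pi y * (Th (x - y) * Th (gam + x + y)))).
{ intros x y. assert (N := e2pi_neq_0 y).
  replace (wronskian x y) with (e2pi y * (e2pi (- y) * wronskian x y))
    by (rewrite e2pi_opp; field; easy).
  rewrite <- theta_product. ring. }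
rewrite !W in G.
transitivity (/ (E 0 * E 0) * 0); [|ring].
rewrite <- G. field. easy.
Qed.

End Poincare.

(** * The transformation to the 0phi1 series *)

Lemma RtoC_exp_neq_0 (B : R) : RtoC (exp B) <> 0.
Proof. intros H. apply (f_equal fst) in H. simpl in H. generalize (exp_pos B). lra. Qed.

Section Hypergeometric.
Variable tau : C.
Hypothesis Htau : (0 < Im tau)%R.
Notation E := (euler_tail tau).
Notation Ph := (poch_add tau).

Definition sqweight (b : C) (n : Z) : C := e2pi (IZR n * b + tau * (IZR n * (IZR n + 1))).

Lemma sqweight_plus_tau (b : C) (n : Z) :
  sqweight (b + tau) n = e2pi (IZR n * tau) * sqweight b n.
Proof. unfold sqweight. rewrite <- !e2pi_plus. f_equal. ring. Qed.

(** The product of the two tails grows at half the rate of the weight, by the bound for pairs. The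
    place of [g] is later taken by a cut-off factor divided by its bound. *)
Lemma sqweight_pair_domK (b A : C) : exists K, forall g : Z -> C,
  (forall n, (Cmod (g n) <= 1)%R) ->
  domK K (fun n => sqweight b n * (E n * Ph (A - IZR n * tau) * g n)).
Proof.
assert (P := two_PI_tau_pos tau Htau).
destruct (poch_add_pair_bound tau Htau tau A) as [c [d Hd]].
destruct (domK_quad 0 (b + tau) tau c d (PI * Im tau)) as [K HK]; [lra|].
exists K. intros g Hg.
apply HK with (fun n => E n * Ph (A - IZR n * tau) * g n).
- intros n. rewrite Cmod_mult.
  eapply Rle_trans; [|apply (Hd n)].
  replace (tau + IZR n * tau) with (IZR (n + 1) * tau) by (push_IZR; ring). fold (E n).
  rewrite <- (Rmult_1_r (Cmod (E n * Ph (A - IZR n * tau)))) at 2.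
  apply Rmult_le_compat_l; [apply Cmod_ge_0|apply Hg].
- intros n. unfold sqweight. f_equal. f_equal. ring.
Qed.

Lemma E_Ph_bound (c : C) : exists B, forall n,
  (Cmod (E n * Ph (c + IZR (n + 1) * tau)) <= exp B)%R.
Proof.
destruct (euler_tail_bound tau Htau) as [B [HB0 HB]].
eexists. intros n. rewrite Cmod_mult.
destruct (Z.lt_ge_cases n 0) as [Hn|Hn].
- rewrite euler_tail_neg by easy. rewrite Cmod_0, Rmult_0_l. apply Rlt_le, exp_pos.
- eapply Rle_trans.
  + apply Rmult_le_compat; try apply Cmod_ge_0; [apply HB|].
    apply Clim_le with (fun N => poch_trunc tau N (c + IZR (n + 1) * tau)); [now apply poch_add_lim|].
    exists 0%nat; intros N _. apply poch_trunc_bound_right; [easy|]. apply IZR_le. lia.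
  + rewrite <- exp_plus. apply Rle_refl.
Qed.

Lemma sqweight_domK (b : C) (B : R) : exists K, forall g : Z -> C,
  (forall n, (Cmod (g n) <= exp B)%R) -> domK K (fun n => sqweight b n * g n).
Proof.
assert (P := two_PI_tau_pos tau Htau).
destruct (domK_quad 0 (b + tau) tau B 0 0) as [K HK]; [lra|].
exists K. intros g Hg. apply HK with g.
- intros n. eapply Rle_trans; [apply Hg|]. apply exp_le. lra.
- intros n. unfold sqweight. f_equal. f_equal. ring.
Qed.

Section Transformation.
Variable c : C.
Hypothesis Hc : forall n : Z, e2pi (c + IZR n * tau) <> 1.

(** The last factor cuts the sum off to 0 <= n <= N and tends to 1 as N grows; it makes an induction
    on N possible, here and in [rhs_term]. *)
Definition lhs_term (A : C) (N : nat) (n : Z) : C :=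
  sqweight (c - A) n * (E n * Ph (A - IZR n * tau) * E (Z.of_nat N - n)).

Definition rhs_term (b : C) (N : nat) (n : Z) : C :=
  sqweight b n * (E n * Ph (c + IZR (n + 1) * tau) * E (Z.of_nat N - n)).

Lemma lhs_term_domK (A : C) : exists K, forall N, domK K (lhs_term A N).
Proof.
destruct (sqweight_pair_domK (c - A) A) as [K HK].
destruct (euler_tail_bound tau Htau) as [B [HB0 HB]].
exists (exp B * K)%R. intros N n. unfold lhs_term.
assert (Hg : forall m, (Cmod (E (Z.of_nat N - m) / RtoC (exp B)) <= 1)%R).
{ intros m. rewrite Cmod_div by apply RtoC_exp_neq_0.
  rewrite Cmod_R, Rabs_pos_eq by (apply Rlt_le, exp_pos).
  apply Rmult_le_reg_r with (exp B); [apply exp_pos|].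
  unfold Rdiv. rewrite Rmult_assoc, Rinv_l by (generalize (exp_pos B); lra).
  generalize (HB (Z.of_nat N - m)%Z). lra. }
assert (H := HK _ Hg n). cbv beta in H.
replace (sqweight (c - A) n * (E n * Ph (A - IZR n * tau) * E (Z.of_nat N - n))) with
  (exp B * (sqweight (c - A) n * (E n * Ph (A - IZR n * tau) * (E (Z.of_nat N - n) / exp B))))
  by (field; apply RtoC_exp_neq_0).
rewrite Cmod_mult, Cmod_R, Rabs_pos_eq by (apply Rlt_le, exp_pos).
rewrite Rmult_assoc. apply Rmult_le_compat_l; [apply Rlt_le, exp_pos|exact H].
Qed.

Lemma rhs_term_domK (b : C) : exists K, forall N, domK K (rhs_term b N).
Proof.
destruct (E_Ph_bound c) as [B HB].
destruct (euler_tail_bound tau Htau) as [B' [_ HB']].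
destruct (sqweight_domK b (B + B')) as [K HK].
exists K. intros N. apply HK. intros n. rewrite Cmod_mult, exp_plus.
apply Rmult_le_compat; auto; apply Cmod_ge_0.
Qed.

Lemma lhs_term_dom (A : C) (N : nat) : dom (lhs_term A N).
Proof. destruct (lhs_term_domK A) as [K HK]. now exists K. Qed.

Lemma rhs_term_dom (b : C) (N : nat) : dom (rhs_term b N).
Proof. destruct (rhs_term_domK b) as [K HK]. now exists K. Qed.

Lemma euler_tail_pred_eq (m n : Z) : (m = n - 1)%Z -> E m = (1 - e2pi (IZR n * tau)) * E n.
Proof. intros ->. now apply euler_tail_pred. Qed.

Lemma e2pi_diff (N : nat) (n : Z) :
  e2pi (IZR (Z.of_nat N + 1 - n) * tau) = e2pi (IZR (Z.of_nat N + 1) * tau) / e2pi (IZR n * tau).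
Proof. rewrite <- e2pi_minus. f_equal. push_IZR. ring. Qed.

(** A q-Pascal rule: 1 - q^(N+1) = (1 - q^(N+1-n)) + q^(N+1-n) (1 - q^n). Each bracket lowers the
    index of one tail by one, and in the second part the shift of n turns A into A - tau. *)
Lemma lhs_rec (A : C) (N : nat) :
  (1 - e2pi (IZR (Z.of_nat N + 1) * tau)) * sumZ (lhs_term A (S N))
  = sumZ (lhs_term A N)
    + e2pi (c - A + tau) * e2pi (IZR (Z.of_nat N + 1) * tau) * sumZ (lhs_term (A - tau) N).
Proof.
set (P := e2pi (IZR (Z.of_nat N + 1) * tau)).
rewrite <- (sumZ_shift (lhs_term (A - tau) N) (-1)) by apply lhs_term_dom.
assert (D := dom_shift _ (-1) (lhs_term_dom (A - tau) N)).
rewrite <- !sumZ_scal, <- sumZ_plus by (try apply dom_scal; auto; apply lhs_term_dom).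
apply sumZ_ext; [apply dom_scal, lhs_term_dom|].
intros n. unfold lhs_term.
replace (Z.of_nat (S N) - n)%Z with (Z.of_nat N + 1 - n)%Z by lia.
replace (Z.of_nat N - (n + -1))%Z with (Z.of_nat N + 1 - n)%Z by lia.
rewrite (euler_tail_pred_eq (n + -1) n), (euler_tail_pred_eq (Z.of_nat N - n) (Z.of_nat N + 1 - n)) by lia.
rewrite e2pi_diff. fold P.
set (y := e2pi (IZR n * tau)). assert (Ny : y <> 0) by apply e2pi_neq_0.
replace (A - tau - IZR (n + -1) * tau) with (A - IZR n * tau) by (push_IZR; ring).
replace (sqweight (c - (A - tau)) (n + -1)) with
  (sqweight (c - A) n / (e2pi (c - A + tau) * y)).
2:{ unfold sqweight, y. rewrite <- e2pi_plus, <- e2pi_minus. f_equal. push_IZR. ring. }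
field. split; [easy|apply e2pi_neq_0].
Qed.

Lemma rhs_rec (b : C) (N : nat) :
  (1 - e2pi (IZR (Z.of_nat N + 1) * tau)) * (1 - e2pi (c + IZR (Z.of_nat N + 1) * tau))
    * sumZ (rhs_term b (S N))
  = sumZ (rhs_term b N)
    + e2pi (IZR (Z.of_nat N + 1) * tau) * (e2pi (b + tau) - e2pi c)
      * sumZ (rhs_term (b + tau) N).
Proof.
set (P := e2pi (IZR (Z.of_nat N + 1) * tau)).
set (t := rhs_term (b + tau) N).
set (k := e2pi (b + tau) * P).
assert (Dt : dom t) by apply rhs_term_dom.
assert (Dt' := dom_shift _ (-1) Dt).
(* The last bracket is zero, a sum minus its translate; with it added the identity holds term by
   term. *)
transitivity (sumZ (rhs_term b N) + P * (e2pi (b + tau) - e2pi c) * sumZ t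
  + (k * sumZ (fun n => t (n + -1)%Z) + - k * sumZ t)).
2:{ rewrite sumZ_shift by easy. ring. }
rewrite <- !sumZ_scal, <- !sumZ_plus
  by (repeat (apply dom_plus || apply dom_scal); auto; apply rhs_term_dom).
apply sumZ_ext; [apply dom_scal, rhs_term_dom|].
intros n. unfold t, rhs_term.
replace (Z.of_nat (S N) - n)%Z with (Z.of_nat N + 1 - n)%Z by lia.
replace (Z.of_nat N - (n + -1))%Z with (Z.of_nat N + 1 - n)%Z by lia.
rewrite (euler_tail_pred_eq (n + -1) n), (euler_tail_pred_eq (Z.of_nat N - n) (Z.of_nat N + 1 - n)) by lia.
rewrite e2pi_diff. fold P.
replace (n + -1 + 1)%Z with n by ring.
rewrite (poch_add_step tau Htau (c + IZR n * tau)).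
replace (c + IZR n * tau + tau) with (c + IZR (n + 1) * tau) by (push_IZR; ring).
rewrite !e2pi_plus. fold P.
rewrite sqweight_plus_tau.
set (y := e2pi (IZR n * tau)). assert (Ny : y <> 0) by apply e2pi_neq_0.
replace (sqweight (b + tau) (n + -1)) with (sqweight b n / (e2pi (b + tau) * y)).
2:{ unfold sqweight, y. rewrite <- e2pi_plus, <- e2pi_minus. f_equal. push_IZR. ring. }
unfold k. rewrite e2pi_plus. field. repeat split; auto; apply e2pi_neq_0.
Qed.

Lemma pow_tau_neq_1 (N : nat) : e2pi (IZR (Z.of_nat N + 1) * tau) <> 1.
Proof.
intros H. assert (P := two_PI_tau_pos tau Htau).
assert (H1 : Cmod (e2pi (IZR (Z.of_nat N + 1) * tau)) = 1) by now rewrite H, Cmod_1.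
rewrite Cmod_e2pi in H1.
assert (exp (- (2 * PI * Im (IZR (Z.of_nat N + 1) * tau))) < exp 0)%R.
{ apply exp_increasing.
  replace (Im (IZR (Z.of_nat N + 1) * tau)) with (IZR (Z.of_nat N + 1) * Im tau)%R
    by (destruct tau; simpl; ring).
  assert (0 < IZR (Z.of_nat N + 1))%R by (apply IZR_lt; lia). nra. }
rewrite exp_0 in *. lra.
Qed.

(** A stays quantified in the induction because the recurrence leads to A - tau. The coefficients of
    the two recurrences agree since e2pi(c - A + tau) (1 - e2pi(A - tau)) = e2pi(c - A + tau) - e2pi
    c. *)
Lemma finite_transformation (N : nat) : forall A,
  Ph (c + IZR (Z.of_nat N + 1) * tau) * sumZ (lhs_term A N) = Ph A * sumZ (rhs_term (c - A) N).
Proof.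
induction N as [|N IH]; intros A.
- rewrite !sumZ_finite0.
  + unfold lhs_term, rhs_term, sqweight. simpl.
    replace (A - 0 * tau) with A by ring. 
    replace (0 * (c - A) + tau * (0 * (0 + 1))) with (RtoC 0) by ring. rewrite e2pi_0. ring.
  + intros n Hn. unfold rhs_term. simpl.
    destruct (Z.lt_ge_cases n 0) as [H|H].
    * rewrite (euler_tail_neg tau Htau n) by easy. ring.
    * rewrite (euler_tail_neg tau Htau (- n)) by lia. ring.
  + intros n Hn. unfold lhs_term. simpl.
    destruct (Z.lt_ge_cases n 0) as [H|H].
    * rewrite (euler_tail_neg tau Htau n) by easy. ring.
    * rewrite (euler_tail_neg tau Htau (- n)) by lia. ring.
- assert (R1 := lhs_rec A N). assert (R2 := rhs_rec (c - A) N).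
  assert (I1 := IH A). assert (I2 := IH (A - tau)).
  replace (c - (A - tau)) with (c - A + tau) in I2 by ring.
  rewrite (poch_add_step tau Htau (c + IZR (Z.of_nat N + 1) * tau)) in I1, I2.
  rewrite (poch_add_step tau Htau (A - tau)) in I2.
  replace (A - tau + tau) with A in I2 by ring.
  replace (c + IZR (Z.of_nat N + 1) * tau + tau) with
    (c + IZR (Z.of_nat (S N) + 1) * tau) in I1, I2.
  2:{ replace (Z.of_nat (S N) + 1)%Z with (Z.of_nat N + 1 + 1)%Z by lia.
      rewrite (plus_IZR _ 1), RtoC_plus. ring. }
  assert (N1 := pow_tau_neq_1 N). assert (N2 := Hc (Z.of_nat N + 1)).
  set (P := e2pi (IZR (Z.of_nat N + 1) * tau)) in *.
  set (pP := e2pi (c + IZR (Z.of_nat N + 1) * tau)) in *.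
  set (X := Ph (c + IZR (Z.of_nat (S N) + 1) * tau)) in *.
  assert (M1 : 1 - P <> 0).
  { intros H. apply N1. replace P with (1 - (1 - P)) by ring. rewrite H. ring. }
  assert (M2 : 1 - pP <> 0).
  { intros H. apply N2. replace pP with (1 - (1 - pP)) by ring. rewrite H. ring. }
  transitivity (/ ((1 - P) * (1 - pP)) *
    ((1 - pP) * X * ((1 - P) * sumZ (lhs_term A (S N))))); [field; now split|].
  transitivity (/ ((1 - P) * (1 - pP)) *
    (Ph A * ((1 - P) * (1 - pP) * sumZ (rhs_term (c - A) (S N))))); [|field; now split].
  f_equal. rewrite R1, R2, Cmult_plus_distr_l, I1.
  transitivity (Ph A * sumZ (rhs_term (c - A) N)
    + e2pi (c - A + tau) * P * ((1 - pP) * X * sumZ (lhs_term (A - tau) N))); [ring|].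
  rewrite I2, e2pi_plus, !e2pi_minus. field. split; apply e2pi_neq_0.
Qed.

Definition lhs_limit (A : C) (n : Z) : C := sqweight (c - A) n * (E n * Ph (A - IZR n * tau)).
Definition rhs_limit (b : C) (n : Z) : C := sqweight b n * (E n * Ph (c + IZR (n + 1) * tau)).

Lemma euler_tail_sub_lim (n : Z) (x y : C) : Clim (fun N => x * (y * E (Z.of_nat N - n))) (x * y).
Proof.
eapply Clim_eq; [apply Clim_scal, Clim_scal|].
- apply Clim_ext with (fun N => E (1 * Z.of_nat N + - n)); [intros N; f_equal; lia|].
  now apply euler_tail_lim.
- ring.
Qed.

Lemma lhs_limit_dom (A : C) : dom (lhs_limit A).
Proof.
destruct (lhs_term_domK A) as [K HK]. exists K.
apply (tannery K (lhs_term A)); [exact HK|]. intros n. apply euler_tail_sub_lim.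
Qed.

(** Up to common factors this is the classical identity 1phi1(b; 0; q, z) = (z)_oo 0phi1(-; z; q,
    bz) with b = q / e2pi A and z = q e2pi c. *)
Lemma transformation (A : C) : sumZ (lhs_limit A) = Ph A * sumZ (rhs_limit (c - A)).
Proof.
destruct (lhs_term_domK A) as [K HK]. destruct (rhs_term_domK (c - A)) as [K' HK'].
apply Clim_unique with (fun N => Ph A * sumZ (rhs_term (c - A) N)).
- apply Clim_ext with
    (fun N => Ph (c + tau + INR N * tau) * sumZ (lhs_term A N)).
  + intros N. rewrite <- finite_transformation. f_equal. f_equal.
    push_IZR. rewrite <- INR_IZR_INZ. ring.
  + eapply Clim_eq; [apply Clim_mult; [now apply poch_add_shift_lim|]|].
    * apply (tannery K (lhs_term A)); [exact HK|]. intros n. apply euler_tail_sub_lim.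
    * unfold lhs_limit. ring.
- apply Clim_scal. apply (tannery K' (rhs_term (c - A))); [exact HK'|].
  intros n. apply euler_tail_sub_lim.
Qed.

Lemma rhs_limit_phi01 (b : C) :
  sumZ (rhs_limit b) = E 0 * Ph (c + tau) * phi01 tau (e2pi (c + tau)) (e2pi (b + 2 * tau)).
Proof.
assert (N0 := euler_tail_0_neq_0 tau Htau).
assert (NP : forall n : Z, Ph (c + IZR n * tau) <> 0).
{ intros n. apply poch_add_neq_0; [easy|]. intros j Hj. apply (Hc (n + Z.of_nat j)).
  rewrite <- Hj. f_equal. push_IZR. rewrite <- INR_IZR_INZ. ring. }
assert (N1 : Ph (c + tau) <> 0).
{ replace (c + tau) with (c + IZR 1 * tau) by (simpl; ring). apply NP. }
assert (D : dom (rhs_limit b)).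
{ destruct (rhs_term_domK b) as [K HK]. exists K.
  apply (tannery K (rhs_term b)); [exact HK|]. intros n. apply euler_tail_sub_lim. }
(* With the constant moved inside, the half over n >= 0 agrees with the series [phi01] term by term;
   the other half is a series of zeros, whose [iota] value still has to be computed. *)
set (k := / (E 0 * Ph (c + tau))).
enough (H : k * sumZ (rhs_limit b) = phi01 tau (e2pi (c + tau)) (e2pi (b + 2 * tau))).
{ rewrite <- H. unfold k. field. now split. }
rewrite <- sumZ_scal by easy. unfold Cseries_Z, phi01.
replace (fun n : nat => k * rhs_limit b (- Z.of_nat (S n))%Z) with (fun n : nat => RtoC 0).
2:{ apply functional_extensionality. intros n. unfold rhs_limit.
    rewrite euler_tail_neg by (easy || lia). ring. }
replace (Cseries (fun _ => 0)) with (RtoC 0).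
2:{ symmetry. unfold Cseries.
    apply (iota_filterlim_locally (V := C_CompleteNormedModule) (F := eventually)
      (sum_n (fun _ : nat => (RtoC 0 : C_CompleteNormedModule)))).
    apply Clim_filterlim. apply Clim_ext with (fun _ => 0); [|apply Clim_const].
    intros n; induction n as [|n IH].
    - now rewrite sum_O.
    - rewrite sum_Sn, <- IH. unfold plus; simpl. ring. }
rewrite Cplus_0_r. f_equal. apply functional_extensionality. intros n.
unfold qpoch, qpow, nome.
rewrite <- !e2pi_plus.
fold (Ph (c + tau)) (Ph (tau * IZR (Z.of_nat n) + (c + tau))) (Ph tau)
  (Ph (tau * IZR (Z.of_nat n) + tau)).
rewrite <- e2pi_INR.
replace (Ph tau) with (E 0) by (unfold euler_tail; f_equal; simpl; ring).
replace (Ph (tau * IZR (Z.of_nat n) + tau)) with (E (Z.of_nat n))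
  by (unfold euler_tail; f_equal; push_IZR; ring).
replace (tau * IZR (Z.of_nat n) + (c + tau)) with (c + IZR (Z.of_nat n + 1) * tau)
  by (push_IZR; ring).
unfold rhs_limit, k.
assert (N2 := NP (Z.of_nat n + 1)%Z).
assert (N3 : E (Z.of_nat n) <> 0).
{ apply poch_add_neq_0; [easy|]. intros j Hj. apply (pow_tau_neq_1 (n + j)).
  rewrite <- Hj. f_equal. rewrite Nat2Z.inj_add. push_IZR. rewrite <- !INR_IZR_INZ. ring. }
replace (sqweight b (Z.of_nat n)) with
  (e2pi (tau * (INR n * (INR n - 1))) * e2pi (INR n * (b + 2 * tau))).
2:{ unfold sqweight. rewrite <- e2pi_plus, <- INR_IZR_INZ. f_equal. ring. }
field. repeat split; assumption.
Qed.

Lemma lhs_limit_phi01 (A : C) :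
  sumZ (lhs_limit A)
  = Ph A * (E 0 * Ph (c + tau) * phi01 tau (e2pi (c + tau)) (e2pi (c - A + 2 * tau))).
Proof. now rewrite transformation, rhs_limit_phi01. Qed.

End Transformation.
End Hypergeometric.

(** * The mu-function *)

Section Mu.
Variable tau : C.
Hypothesis Htau : (0 < Im tau)%R.
Notation E := (euler_tail tau).
Notation Ph := (poch_add tau).
Notation Th := (theta_add tau).

Lemma theta_add_shift (z : C) (m : Z) :
  Th (z + IZR m * tau) = e2pi (IZR m / 2 - IZR m * z - tau * (IZR m * (IZR m - 1) / 2)) * Th z.
Proof.
induction m as [|m IH|m IH] using Z.peano_ind.
- replace (z + IZR 0 * tau) with z by (simpl; ring).
  replace (IZR 0 / 2 - IZR 0 * z - tau * (IZR 0 * (IZR 0 - 1) / 2)) with (RtoC 0)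
    by (simpl; field).
  rewrite e2pi_0. ring.
- replace (z + IZR (Z.succ m) * tau) with (z + IZR m * tau + tau)
    by (unfold Z.succ; push_IZR; ring).
  rewrite theta_add_plus_tau, IH by easy.
  rewrite <- e2pi_half_shift, Cmult_assoc, <- e2pi_plus. f_equal. f_equal.
  unfold Z.succ; push_IZR; field.
- assert (S := theta_add_plus_tau tau Htau (z + IZR (Z.pred m) * tau)).
  replace (Z.pred m) with (m - 1)%Z in * by lia.
  replace (z + IZR (m - 1) * tau + tau) with (z + IZR m * tau) in S by (push_IZR; ring).
  set (w := z + IZR (m - 1) * tau) in *.
  assert (N := e2pi_neq_0 (- w)).
  replace (Th w) with (- e2pi w * Th (z + IZR m * tau)).
  2:{ rewrite S. replace (e2pi w) with (/ e2pi (- w)).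
      - field; easy.
      - rewrite e2pi_opp. field. apply e2pi_neq_0. }
  rewrite IH, Cmult_assoc, <- e2pi_half_shift, <- e2pi_plus. f_equal.
  (* The half-integer signs of the two sides agree only modulo 1. *)
  apply (e2pi_eq_mod_1 1). unfold w; push_IZR; field.
Qed.

(** Neither gam nor the pair depends on s: C = xy/a is formed with the unshifted x and y. Hence the
    values of mu at different shifts belong to one and the same Poincare series. *)
Definition mu_numerator (u v alpha s : C) : C :=
  poincare tau (u + v - tau * alpha) (poch_pair tau u (tau + tau * alpha - u)) s.

Lemma mu_numerator_dom (u v alpha s : C) :
  dom (fun m => weight tau (u + v - tau * alpha) s m
                * poch_pair tau u (tau + tau * alpha - u) (s + IZR m * tau)).
Proof. now apply poincare_poch_pair_lim. Qed.

Lemma mu_eq (u v alpha s : C) :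
  (forall n : Z, e2pi (v + s + IZR n * tau) <> 1) ->
  (forall n : Z, e2pi (u + s - tau * alpha + IZR n * tau) <> 1) ->
  mu tau (u + s) (v + s) alpha =
    - Ci * qpow tau (- (1 / 8)) * Cexp (PI * Ci * alpha * (u - v))
    * mu_numerator u v alpha s / (E 0 * Th (v + s) * Th (u + s - tau * alpha)).
Proof.
intros Hv Hu.
assert (N0 := euler_tail_0_neq_0 tau Htau).
assert (N1 := theta_add_neq_0 tau Htau _ Hv). assert (N2 := theta_add_neq_0 tau Htau _ Hu).
set (zeta := u + s - tau * alpha) in *.
unfold mu. rewrite vartheta11_Th by easy.
replace (u + s - (v + s)) with (u - v) by ring.
set (k := - e2pi (- (v + s) / 2) / Th zeta).
set (h := fun m => weight tau (u + v - tau * alpha) s m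
                * poch_pair tau u (tau + tau * alpha - u) (s + IZR m * tau)).
assert (Dh : dom h) by apply mu_numerator_dom.
assert (S : Cseries_Z (fun n : Z => (- (1)) ^ Z.abs_nat n * e2pi ((IZR n + 1 / 2) * (v + s))
      * qpow tau (IZR n * (IZR n + 1) / 2)
      * (qpoch_inf tau (e2pi (u + s) * qpow tau (IZR n + 1))
         / qpoch_inf tau (e2pi (u + s) * qpow tau (IZR n - alpha + 1))))
   = k * mu_numerator u v alpha s).
{ unfold mu_numerator, poincare. fold h.
  rewrite <- (sumZ_succ h Dh), <- sumZ_scal by now apply dom_shift.
  symmetry. apply sumZ_ext; [now apply dom_scal, dom_shift|].
  intros n. rewrite sign_e2pi. unfold qpow. rewrite <- !e2pi_plus.
  fold (Ph (u + s + tau * (IZR n + 1))). fold (Ph (u + s + tau * (IZR n - alpha + 1))).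
  unfold h, poch_pair.
  replace (u + (s + IZR (n + 1) * tau)) with (u + s + tau * (IZR n + 1)) by (push_IZR; ring).
  replace (u + s + tau * (IZR n - alpha + 1)) with (zeta + IZR (n + 1) * tau)
    by (unfold zeta; push_IZR; ring).
  (* [T] trades the product in the denominator for one in the numerator over [Th zeta]; the Gaussian
     factor it costs goes into [weight]. *)
  assert (T := theta_add_shift zeta (n + 1)). unfold theta_add at 1 in T.
  replace (tau - (zeta + IZR (n + 1) * tau)) with
    (tau + tau * alpha - u - (s + IZR (n + 1) * tau)) in T by (unfold zeta; push_IZR; ring).
  assert (N3 : Ph (zeta + IZR (n + 1) * tau) <> 0).
  { apply poch_add_neq_0; [easy|]. intros j Hj. apply (Hu (n + 1 + Z.of_nat j)%Z).
    rewrite <- Hj. f_equal. push_IZR. rewrite <- INR_IZR_INZ. ring. }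
  replace (Ph (tau + tau * alpha - u - (s + IZR (n + 1) * tau))) with
    (e2pi (IZR (n + 1) / 2 - IZR (n + 1) * zeta - tau * (IZR (n + 1) * (IZR (n + 1) - 1) / 2))
       * Th zeta / Ph (zeta + IZR (n + 1) * tau)) by (rewrite <- T; field; easy).
  replace (e2pi (IZR n / 2 + (IZR n + 1 / 2) * (v + s) + tau * (IZR n * (IZR n + 1) / 2))) with
   (- e2pi (- (v + s) / 2) * (weight tau (u + v - tau * alpha) s (n + 1) *
     e2pi (IZR (n + 1) / 2 - IZR (n + 1) * zeta - tau * (IZR (n + 1) * (IZR (n + 1) - 1) / 2)))).
  2:{ unfold weight. rewrite <- e2pi_plus, <- e2pi_half_shift, <- e2pi_plus.
      apply (e2pi_eq_mod_1 1). unfold zeta. push_IZR. field. }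
  unfold k. field. now split. }
rewrite S. unfold k, qpow.
replace (tau * - (1 / 8)) with (- (tau / 8)) by field. rewrite e2pi_opp.
assert (N4 := e2pi_neq_0 (tau / 8)). assert (N5 := e2pi_neq_0 (- (v + s) / 2)).
assert (Ci2 : Ci * Ci = - (1)) by (apply injective_projections; simpl; ring).
assert (NC : Ci <> 0).
{ intros H. rewrite H in Ci2. apply (f_equal fst) in Ci2. simpl in Ci2. lra. }
transitivity (Cexp (PI * Ci * alpha * (u - v)) * mu_numerator u v alpha s
   / (Ci * e2pi (tau / 8) * (E 0 * Th (v + s) * Th zeta))).
- field. repeat split; auto.
- replace (- Ci) with (/ Ci) by apply Ci_inv.
  field. repeat split; auto.
Qed.

(** With w = 1/x the factor (xwq^m)_oo is (q^m)_oo, zero for m <= 0, so the sum starts at m = 1; the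
    exponential in front is the weight at m = 1. *)
Lemma mu_numerator_at_opp_u (u v alpha : C) :
  (forall n : Z, e2pi (v - u + IZR n * tau) <> 1) ->
  mu_numerator u v alpha (- u) =
    e2pi (v - u - tau * alpha) * (Ph (tau * alpha) * (E 0 * Ph (v - u + tau)
      * phi01 tau (e2pi (v - u + tau)) (e2pi (v - u - tau * alpha + 2 * tau)))).
Proof.
intros H. rewrite <- lhs_limit_phi01 by easy.
assert (D := lhs_limit_dom tau Htau (v - u) (tau * alpha)).
rewrite <- sumZ_scal by easy.
unfold mu_numerator, poincare.
rewrite <- (sumZ_succ _ (mu_numerator_dom u v alpha (- u))).
symmetry. apply sumZ_ext; [now apply dom_scal|].
intros n. unfold lhs_limit, poch_pair. rewrite Cmult_assoc. f_equal.
- unfold sqweight, weight. rewrite <- e2pi_plus. f_equal. push_IZR. ring.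
- unfold euler_tail. f_equal; f_equal; push_IZR; ring.
Qed.

(** With w = a/x the second product is (q^(1-m))_oo, zero for m >= 1. The sum over m = -n starts at
    m = 0, whose weight is 1, so no exponential appears in front. *)
Lemma mu_numerator_at_a_over_x (u v alpha : C) :
  (forall n : Z, e2pi (u - v + IZR n * tau) <> 1) ->
  mu_numerator u v alpha (tau * alpha - u) =
    Ph (tau * alpha) * (E 0 * Ph (u - v + tau)
      * phi01 tau (e2pi (u - v + tau)) (e2pi (u - v - tau * alpha + 2 * tau))).
Proof.
intros H. rewrite <- lhs_limit_phi01 by easy.
assert (D := lhs_limit_dom tau Htau (u - v) (tau * alpha)).
unfold mu_numerator, poincare.
rewrite <- (sumZ_opp _ (mu_numerator_dom u v alpha (tau * alpha - u))).
symmetry. apply sumZ_ext; [easy|].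
intros n. unfold lhs_limit, poch_pair. f_equal.
- unfold sqweight, weight. f_equal. push_IZR. ring.
- rewrite Cmult_comm. unfold euler_tail. f_equal; f_equal; push_IZR; ring.
Qed.

Lemma mu_numerator_three_term (u v alpha s t : C) :
  mu_numerator u v alpha 0 * e2pi t
    * (Th (s - t) * Th (u + v - tau * alpha + s + t))
  + mu_numerator u v alpha s * (Th t * Th (u + v - tau * alpha + t))
  + mu_numerator u v alpha t * e2pi s * (Th (- s) * Th (u + v - tau * alpha + s)) = 0.
Proof.
assert (H := three_term tau (u + v - tau * alpha) Htau (mu_numerator u v alpha) 0 s t
  (mono_span_poch_pair tau _ Htau _ _)).
rewrite e2pi_0 in H.
replace (t - 0) with t in H by ring. replace (0 - s) with (- s) in H by ring.
replace (u + v - tau * alpha + t + 0) with (u + v - tau * alpha + t) in H by ring.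
replace (u + v - tau * alpha + 0 + s) with (u + v - tau * alpha + s) in H by ring.
refine (eq_trans _ H). ring.
Qed.

Lemma not_qint_neq_1 (z : C) :
  ~ is_int_qpow tau (e2pi z) -> forall n : Z, e2pi (z + IZR n * tau) <> 1.
Proof.
intros H n Hn. apply H. exists (- n)%Z. unfold qpow.
replace (e2pi z) with (e2pi (z + IZR n * tau) * e2pi (tau * IZR (- n))).
- rewrite Hn. ring.
- rewrite <- e2pi_plus. f_equal. push_IZR. ring.
Qed.

(** Removes the factors q^(-2) inside the thetas of the three formulas. *)
Lemma theta_add_minus_2tau (z : C) :
  Th (z - 2 * tau) = e2pi z * e2pi z / (e2pi tau * e2pi tau * e2pi tau) * Th z.
Proof.
replace (z - 2 * tau) with (z + IZR (-2) * tau) by (push_IZR; ring).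
rewrite theta_add_shift.
transitivity (e2pi (z + z - (tau + tau + tau)) * e2pi (IZR (-1)) * Th z).
- rewrite <- e2pi_plus. f_equal. f_equal. push_IZR. field.
- rewrite e2pi_IZR, e2pi_minus, !e2pi_plus. ring.
Qed.

End Mu.

Lemma e2pi_double (z : C) : e2pi (2 * z) = e2pi z * e2pi z.
Proof. rewrite <- e2pi_plus. f_equal. ring. Qed.

Lemma solve_linear (h c d r1 r2 : C) :
  c * d <> 0 -> h * c * d + r1 + r2 = 0 -> h = - (r1 + r2) / (c * d).
Proof.
intros N H. replace (r1 + r2) with (h * c * d + r1 + r2 - h * (c * d)) by ring.
rewrite H.
transitivity (h * (c * d) / (c * d)).
- unfold Cdiv. rewrite <- Cmult_assoc, Cinv_r by easy. ring.
- f_equal. ring.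
Qed.

Lemma Copp_neq_0 (z : C) : z <> 0 -> - z <> 0.
Proof. intros N H. apply N. replace z with (- - z) by ring. rewrite H. ring. Qed.

Ltac expand_e2pi :=
  repeat rewrite ?e2pi_minus, ?e2pi_plus, ?e2pi_opp, ?e2pi_double.

Ltac e2pi_field :=
  repeat match goal with v := _ |- _ => progress unfold v end;
  unfold nome, qpow;
  expand_e2pi; field; repeat split; apply e2pi_neq_0.

Ltac neq_0 :=
  repeat match goal with
  | |- Cmult _ _ <> _ => apply Cmult_neq_0
  | |- Copp _ <> _ => apply Copp_neq_0
  end; auto.

Ltac th_at z w :=
  match goal with |- context [theta ?tau z] =>
    replace (theta tau z) with (theta_add tau w) by (rewrite <- theta_Th; f_equal; e2pi_field)
  end.

(* s and t are logarithms of x' and y' on the scale of u and v: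
   mu(xx', yx'; a) is mu (u + s) (v + s) alpha, for any choice of s. *)
Theorem theorem1 (tau u v alpha : C) (Htau : (0 < Im tau)%R) :
  let q := nome tau in
  let x := e2pi u in
  let y := e2pi v in
  let a := qpow tau alpha in
  let xya := Cexp (PI * Ci * alpha * (u - v)) in
  let mi_q8 := - Ci * qpow tau (- (1 / 8)) in
  let th := theta tau in
  let poch := qpoch_inf tau in
  let qint := is_int_qpow tau in
  (forall x' y' s t : C,
     x' <> 0 -> y' <> 0 -> e2pi s = x' -> e2pi t = y' ->
     ~ qint y -> ~ qint (x / a) -> ~ qint (y * x') -> ~ qint (x * x' / a) ->
     ~ qint (y * y') -> ~ qint (x * y' / a) -> ~ qint (y' / x') ->
     ~ qint (x * y * x' * y' / a) ->
     mu tau u v alpha =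
       x' * ((th (x * y * y' / (q ^ 2 * a)) * th (y * x') * th (x * x' / a)
              * th (q / y'))
             / (th (x * y * x' * y' / (q ^ 2 * a)) * th y * th (x / a)
                * th (y' / x')))
          * mu tau (u + s) (v + s) alpha
       + y' * ((th (x * y * x' / (q ^ 2 * a)) * th (x * y' / a) * th (y * y')
                * th (q / x'))
               / (th (x * y * x' * y' / (q ^ 2 * a)) * th y * th (x / a)
                  * th (x' / y')))
            * mu tau (u + t) (v + t) alpha)
  /\
  (forall x' s : C,
     x' <> 0 -> e2pi s = x' ->
     ~ qint y -> ~ qint (x / a) -> ~ qint (y * x') -> ~ qint (x * x' / a) ->
     ~ qint (x * x') -> ~ qint (y * x' / a) -> ~ qint (y / x) ->
     mu tau u v alpha =
       x' * ((th (x / q ^ 2) * th (y * x') * th (x * x' / a) * th (q * y / a))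
             / (th (x * x' / q ^ 2) * th y * th (x / a) * th (a / (y * x'))))
          * mu tau (u + s) (v + s) alpha
       + mi_q8 * xya * (a / y)
         * ((th (x * y * x' / (q ^ 2 * a)) * th (q / x')
             * (poch a * poch (q * y / x)))
            / (th (x * x' / q ^ 2) * th y * th (x / a) * th (y * x' / a)))
         * phi01 tau (q * y / x) (q ^ 2 * y / (a * x)))
  /\
  (~ qint y -> ~ qint (x / a) -> ~ qint a -> ~ qint (x / y) ->
     mu tau u v alpha =
       mi_q8 * xya * (a / x)
         * ((th (x / q ^ 2) * th (q * y / a) * (poch a * poch (q * x / y)))
            / (th (a / q ^ 2) * th y * th (x / a) * th (x / y)))
         * phi01 tau (q * x / y) (q ^ 2 * x / (a * y))
       + mi_q8 * xya * (a / y)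
         * ((th (y / q ^ 2) * th (q * x / a) * (poch a * poch (q * y / x)))
            / (th (a / q ^ 2) * th y * th (x / a) * th (y / x)))
         * phi01 tau (q * y / x) (q ^ 2 * y / (a * x))).

Proof.
intros q x y a xya mi_q8 th poch qint.
assert (N0 := euler_tail_0_neq_0 tau Htau).
assert (TN : forall z w, ~ qint z -> z = e2pi w -> theta_add tau w <> 0).
{ intros z w H Ew. apply theta_add_neq_0; [easy|]. apply not_qint_neq_1. now rewrite <- Ew. }
assert (NE := e2pi_neq_0).
assert (Ea : a = e2pi (tau * alpha)) by easy.
unfold th.
assert (Mu : forall s, ~ qint (e2pi (v + s)) -> ~ qint (e2pi (u + s - tau * alpha)) ->
   mu tau (u + s) (v + s) alpha = mi_q8 * xya * mu_numerator tau u v alpha s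
     / (euler_tail tau 0 * theta_add tau (v + s) * theta_add tau (u + s - tau * alpha))).
{ intros s H1 H2. apply mu_eq; [easy| |]; now apply not_qint_neq_1. }
assert (Mu0 : ~ qint y -> ~ qint (x / a) ->
   mu tau u v alpha = mi_q8 * xya * mu_numerator tau u v alpha 0
     / (euler_tail tau 0 * theta_add tau v * theta_add tau (u - tau * alpha))).
{ intros H1 H2. specialize (Mu 0). rewrite !Cplus_0_r in Mu. apply Mu; [easy|].
  now rewrite e2pi_minus, <- Ea. }
split; [|split].
- intros x' y' s t _ _ <- <- Hy Hxa Hyx Hxxa Hyy Hxya Hyx' Hxyxya.
  rewrite Mu0, !Mu by (try easy; rewrite ?e2pi_minus, ?e2pi_plus, <- ?Ea; easy).
  assert (T := mu_numerator_three_term tau Htau u v alpha s t).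
  (* All thetas are moved to logarithmic arguments and then, by reflection and quasi-periodicity, to
     those occurring in [T]; a rational identity remains. *)
  th_at (x * y * e2pi t / (q ^ 2 * a)) (u + v - tau * alpha + t - 2 * tau).
  th_at (x * y * e2pi s / (q ^ 2 * a)) (u + v - tau * alpha + s - 2 * tau).
  th_at (x * y * e2pi s * e2pi t / (q ^ 2 * a)) (u + v - tau * alpha + s + t - 2 * tau).
  th_at (y * e2pi s) (v + s). th_at (y * e2pi t) (v + t).
  th_at (x * e2pi s / a) (u + s - tau * alpha). th_at (x * e2pi t / a) (u + t - tau * alpha).
  th_at (q / e2pi s) (tau - s). th_at (q / e2pi t) (tau - t).
  th_at y v. th_at (x / a) (u - tau * alpha).
  th_at (e2pi t / e2pi s) (t - s). th_at (e2pi s / e2pi t) (- (t - s)).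
  replace (s - t) with (- (t - s)) in T by ring.
  rewrite ?theta_add_reflect, ?theta_add_minus_2tau, ?theta_add_opp in * by easy.
  assert (theta_add tau v <> 0) by (apply (TN _ _ Hy); e2pi_field).
  assert (theta_add tau (u - tau * alpha) <> 0) by (apply (TN _ _ Hxa); e2pi_field).
  assert (theta_add tau (v + s) <> 0) by (apply (TN _ _ Hyx); e2pi_field).
  assert (theta_add tau (u + s - tau * alpha) <> 0) by (apply (TN _ _ Hxxa); e2pi_field).
  assert (theta_add tau (v + t) <> 0) by (apply (TN _ _ Hyy); e2pi_field).
  assert (theta_add tau (u + t - tau * alpha) <> 0) by (apply (TN _ _ Hxya); e2pi_field).
  assert (theta_add tau (t - s) <> 0) by (apply (TN _ _ Hyx'); e2pi_field).
  assert (theta_add tau (u + v - tau * alpha + s + t) <> 0) by (apply (TN _ _ Hxyxya); e2pi_field).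
  (* Up to exponentials the value at 0 has coefficient Th(t - s) Th(gam + s + t), nonzero by the
     hypotheses on y'/x' and xyx'y'/a. *)
  apply solve_linear in T; [|neq_0].
  rewrite T. expand_e2pi. field. repeat split; auto.
- intros x' s _ <- Hy Hxa Hyx Hxxa Hxx Hyxa Hyox.
  rewrite Mu0, !Mu by (try easy; rewrite ?e2pi_minus, ?e2pi_plus, <- ?Ea; easy).
  (* With t = -u one has s - t = u + s and gam + s + t = v + s - tau alpha, hence the conditions on
     xx' and yx'/a. *)
  assert (T := mu_numerator_three_term tau Htau u v alpha s (- u)).
  rewrite mu_numerator_at_opp_u in T.
  2:{ easy. }
  2:{ apply not_qint_neq_1. now rewrite e2pi_minus. }
  replace (poch a) with (poch_add tau (tau * alpha)) by easy.
  replace (poch (q * y / x)) with (poch_add tau (v - u + tau))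
    by (unfold poch, poch_add; f_equal; e2pi_field).
  replace (phi01 tau (q * y / x) (q ^ 2 * y / (a * x))) with
    (phi01 tau (e2pi (v - u + tau)) (e2pi (v - u - tau * alpha + 2 * tau)))
    by (f_equal; e2pi_field).
  th_at (x / q ^ 2) (u - 2 * tau). th_at (y * e2pi s) (v + s).
  th_at (x * e2pi s / a) (u + s - tau * alpha).
  th_at (q * y / a) (v - tau * alpha + tau).
  th_at (x * e2pi s / q ^ 2) (u + s - 2 * tau).
  th_at y v. th_at (x / a) (u - tau * alpha).
  th_at (a / (y * e2pi s)) (- (v + s - tau * alpha)).
  th_at (y * e2pi s / a) (v + s - tau * alpha).
  th_at (x * y * e2pi s / (q ^ 2 * a)) (u + v - tau * alpha + s - 2 * tau).
  th_at (q / e2pi s) (tau - s).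
  replace (s - - u) with (u + s) in T by ring.
  replace (u + v - tau * alpha + s + - u) with (v + s - tau * alpha) in T by ring.
  replace (u + v - tau * alpha + - u) with (v - tau * alpha) in T by ring.
  rewrite ?theta_add_reflect, ?theta_add_minus_2tau, ?theta_add_plus_tau, ?theta_add_opp in * by easy.
  assert (theta_add tau v <> 0) by (apply (TN _ _ Hy); e2pi_field).
  assert (theta_add tau (u - tau * alpha) <> 0) by (apply (TN _ _ Hxa); e2pi_field).
  assert (theta_add tau (v + s) <> 0) by (apply (TN _ _ Hyx); e2pi_field).
  assert (theta_add tau (u + s - tau * alpha) <> 0) by (apply (TN _ _ Hxxa); e2pi_field).
  assert (theta_add tau (u + s) <> 0) by (apply (TN _ _ Hxx); e2pi_field).
  assert (theta_add tau (v + s - tau * alpha) <> 0) by (apply (TN _ _ Hyxa); e2pi_field).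
  apply solve_linear in T; [|neq_0].
  rewrite T. unfold x, y, a, qpow. expand_e2pi. field. repeat split; auto.
- intros Hy Hxa Ha Hxy.
  rewrite Mu0 by easy.
  (* With both special points s - t = tau alpha and gam + s + t = v - u, hence the conditions on a
     and x/y. *)
  assert (T := mu_numerator_three_term tau Htau u v alpha (tau * alpha - u) (- u)).
  assert (Hxy' : forall n, e2pi (u - v + IZR n * tau) <> 1).
  { apply not_qint_neq_1. now rewrite e2pi_minus. }
  rewrite mu_numerator_at_a_over_x, mu_numerator_at_opp_u in T; try easy.
  2:{ intros n Hn. apply (Hxy' (- n)%Z).
      replace (u - v + IZR (- n) * tau) with (- (v - u + IZR n * tau)) by (push_IZR; ring).
      rewrite e2pi_opp, Hn. field. }
  replace (poch a) with (poch_add tau (tau * alpha)) by easy.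
  replace (poch (q * y / x)) with (poch_add tau (v - u + tau))
    by (unfold poch, poch_add; f_equal; e2pi_field).
  replace (poch (q * x / y)) with (poch_add tau (u - v + tau))
    by (unfold poch, poch_add; f_equal; e2pi_field).
  replace (phi01 tau (q * y / x) (q ^ 2 * y / (a * x))) with
    (phi01 tau (e2pi (v - u + tau)) (e2pi (v - u - tau * alpha + 2 * tau)))
    by (f_equal; e2pi_field).
  replace (phi01 tau (q * x / y) (q ^ 2 * x / (a * y))) with
    (phi01 tau (e2pi (u - v + tau)) (e2pi (u - v - tau * alpha + 2 * tau)))
    by (f_equal; e2pi_field).
  th_at (x / q ^ 2) (u - 2 * tau). th_at (y / q ^ 2) (v - 2 * tau).
  th_at (q * y / a) (v - tau * alpha + tau).
  th_at (q * x / a) (u - tau * alpha + tau).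
  th_at (a / q ^ 2) (tau * alpha - 2 * tau).
  th_at y v. th_at (x / a) (u - tau * alpha).
  th_at (x / y) (u - v). th_at (y / x) (- (u - v)).
  replace (tau * alpha - u - - u) with (tau * alpha) in T by ring.
  replace (u + v - tau * alpha + (tau * alpha - u) + - u) with (- (u - v)) in T by ring.
  replace (u + v - tau * alpha + - u) with (v - tau * alpha) in T by ring.
  replace (- (tau * alpha - u)) with (u - tau * alpha) in T by ring.
  replace (u + v - tau * alpha + (tau * alpha - u)) with v in T by ring.
  rewrite ?theta_add_reflect, ?theta_add_minus_2tau, ?theta_add_plus_tau, ?theta_add_opp in * by easy.
  assert (theta_add tau v <> 0) by (apply (TN _ _ Hy); e2pi_field).
  assert (theta_add tau (u - tau * alpha) <> 0) by (apply (TN _ _ Hxa); e2pi_field).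
  assert (theta_add tau (tau * alpha) <> 0) by (apply (TN _ _ Ha); e2pi_field).
  assert (theta_add tau (u - v) <> 0) by (apply (TN _ _ Hxy); e2pi_field).
  apply solve_linear in T; [|neq_0].
  rewrite T. unfold x, y, a, qpow. expand_e2pi. field. repeat split; auto.
Qed.
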